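(* Let $(E,\hat J,\pi)$ be a pseudoholomorphic vector bundle over an almost complex manifold $(L,J)$, and regard $L$ as the zero section of $E$, which is a pseudoholomorphic submanifold of $(E,\hat J)$. Let $J_0$ be the normally integrable form of $\hat J$, i.e. the normally integrable pseudoholomorphic vector bundle structure on $E$ with $$\hat J=J_0+\tfrac12 J_0N_{\hat J}(r,\cdot),\qquad\text{equivalently}\qquad J_0=\hat J-\tfrac12\hat JN_{\hat J}(r,\cdot).$$ Then, under the natural identification $N_LE\simeq E$, the NB-I structure on the normal bundle $N_LE$ of $L\subset(E,\hat J)$ coincides with $J_0$.
   Context: The Nijenhuis tensor of an almost complex structure $J$ is $N_J(X,Y)=[JX,JY]-J[JX,Y]-J[X,JY]-[X,Y]$. A pseudoholomorphic (PH) vector bundle over $(L,J)$ is a real vector bundle $\pi:(E,\hat J)\to(L,J)$ with fiber $F$ such that $\hat J$ is an almost complex structure on the total space, $\pi_*\hat J=J\pi_*$, the restrictions $\hat J|_{F_x}$ are constant coefficient complex structures, and there exists a linear (not necessarily $J$-linear) connection on $\pi$ whose horizontal lifts $T_xL\to T_aE$, $x=\pi(a)$, are complex linear. It is normally integrable if its Nijenhuis tensor vanishes whenever one argument is vertical. The vector field $r$ on $E$ is the radius-vector field: $r_a=\vec{xa}\in F_x\subset T_aE$, $x=\pi(a)$. NB-I structure: let $L\subset (M,J_M)$ be a pseudoholomorphic submanifold ($TL$ is $J_M$-invariant). An almost complex connection ($\nabla J_M=0$) is minimal if its torsion is $\frac14N_{J_M}$. Choose a minimal connection $\nabla$ on $M$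 whose parallel transports along $L$ preserve $TL$. It induces a linear connection on $N_LM=TM|_L/TL$, hence splittings $T_a(N_LM)=H_a\oplus V_a$ with $H_a\simeq T_xL$ and $V_a\simeq T_xM/T_xL$; the NB-I structure is the direct sum of the complex structure on $H_a$ induced from $J_M|_L$ and the complex structure on $V_a$ induced from $J_M$ on the quotient. It does not depend on the choice of $\nabla$. Here this is applied to $M=E$, $J_M=\hat J$. *)

(* Defs.v *)
From HB Require Import structures.
From mathcomp Require Import all_boot all_order all_algebra.
From mathcomp Require Import all_classical all_reals all_analysis.
From mathcomp Require Import ring.
Set Implicit Arguments.
Unset Strict Implicit.
Unset Printing Implicit Defensive.
Import Order.TTheory GRing.Theory Num.Theory.
Import numFieldNormedType.Exports.
Local Open Scope classical_set_scope.
Local Open Scope ring_scope.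

(** * Smooth functions on open subsets of normed spaces *)

Section Smooth.
Context {R : realType} {V : normedModType R}.

(* [W] is meant to be open: continuity and derivatives are those of [g] on the
   whole space, taken at the points of [W]. *)
Fixpoint Ck_on (W : set V) (k : nat) (g : V -> R) : Prop :=
  (forall u, W u -> {for u, continuous g}) /\
  match k with
  | 0 => True
  | j.+1 => forall v : V,
      (forall u, W u -> derivable g u v) /\ Ck_on W j ('D_v g)
  end.

Definition Cinf_on (W : set V) (g : V -> R) := forall k, Ck_on W k g.

Definition Cinf_at (u : V) (g : V -> R) :=
  exists W : set V, [/\ open W, W u & Cinf_on W g].

End Smooth.

(** * Smooth manifolds *)

(* A chart is a homeomorphism from the open set [chart_dom] onto the open set
   [chart_img];
   outside these sets [chart_coord] and [chart_point] take arbitrary values. *)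
Record chart (R : realType) (M : topologicalType) (n : nat) := Chart {
  chart_dom : set M;
  chart_img : set 'rV[R]_n;
  chart_coord : M -> 'rV[R]_n;
  chart_point : 'rV[R]_n -> M;
  open_dom : open chart_dom;
  open_img : open chart_img;
  coordP : forall p, chart_dom p -> chart_img (chart_coord p) /\ chart_point (chart_coord p) = p;
  pointP : forall u, chart_img u -> chart_dom (chart_point u) /\ chart_coord (chart_point u) = u;
  coord_cont : forall p, chart_dom p -> {for p, continuous chart_coord};
  point_cont : forall u, chart_img u -> {for u, continuous chart_point} }.

Definition smooth_transition (R : realType) (M : topologicalType) (n : nat)
    (c c' : chart R M n) :=
  forall j : 'I_n, Cinf_on [set u | chart_img c u /\ chart_dom c' (chart_point c u)]
                           (fun u => chart_coord c' (chart_point c u) ord0 j).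

(* The atlas is required to be maximal, i.e. it is the smooth structure. *)
Record manifold (R : realType) (n : nat) := Manifold {
  carrier :> topologicalType;
  atlas : set (chart R carrier n);
  manifold_hausdorff : hausdorff_space carrier;
  manifold_countable : @second_countable carrier;
  atlas_cover : forall p : carrier, exists2 c, atlas c & chart_dom c p;
  atlas_smooth : forall c c', atlas c -> atlas c' -> smooth_transition c c';
  atlas_max : forall c,
    (forall c', atlas c' -> smooth_transition c c' /\ smooth_transition c' c) ->
    atlas c }.

Section Manifold.
Context {R : realType} {n : nat} {M : manifold R n}.

(* [f] is smooth on some neighbourhood of [p]. *)
Definition smooth_at (p : M) (f : M -> R) :=
  exists U : set M, [/\ open U, U p &
    forall c, atlas c ->
      Cinf_on [set u | chart_img c u /\ U (chart_point c u)] (f \o chart_point c)].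

(** Tangent vectors are derivations at [p] of the algebra of functions smooth
    near [p].  Functions that are not smooth near [p] are sent to 0, so that a
    tangent vector is determined by its values on smooth functions.  (Locality
    is automatic: apply the Leibniz rule to [h = h * chi] with [h] vanishing
    near [p] and [chi] the indicator of the set where [h] does not vanish.) *)
Definition derivation_at (p : M) (D : (M -> R) -> R) :=
  [/\ forall f, ~ smooth_at p f -> D f = 0,
      forall (a : R) f g, smooth_at p f -> smooth_at p g ->
        D (fun q => a * f q + g q) = a * D f + D g &
      forall f g, smooth_at p f -> smooth_at p g ->
        D (fun q => f q * g q) = f p * D g + g p * D f].

Definition is_derivation (p : M) : {pred (M -> R) -> R} :=
  fun D => `[< derivation_at p D >].

Lemma is_derivation_submod (p : M) : submod_closed (is_derivation p).
Proof.
have fct0 h : (0 : (M -> R) -> R) h = 0 by [].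
have fctZD a (D D' : (M -> R) -> R) h : (a *: D + D') h = a * D h + D' h by [].
split=> [|a D D' /asboolP[D0 DD DM] /asboolP[D'0 D'D D'M]]; apply/asboolP.
  by split=> [//|b f g _ _|f g _ _]; rewrite !fct0 !mulr0 addr0.
split=> [f fp|b f g fp gp|f g fp gp]; rewrite !fctZD.
- by rewrite D0// D'0// mulr0 addr0.
- by rewrite DD// D'D//; ring.
- by rewrite DM// D'M//; ring.
Qed.

HB.instance Definition _ (p : M) :=
  GRing.isSubmodClosed.Build R _ (is_derivation p) (is_derivation_submod p).

Record tangent (p : M) := Tangent {
  tangent_fun :> (M -> R) -> R;
  tangentP : tangent_fun \in is_derivation p }.

HB.instance Definition _ p := [isSub for @tangent_fun p].
HB.instance Definition _ p := [Choice of tangent p by <:].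
HB.instance Definition _ p := [SubChoice_isSubLmodule of tangent p by <:].

(* The tangent vector at [p] acting as [D] on functions smooth near [p]
   (and 0 if [D] is not a derivation). *)
Definition mkT (p : M) (D : (M -> R) -> R) : tangent p :=
  insubd (0 : tangent p) (fun f => if `[< smooth_at p f >] then D f else 0).

Definition vfield := forall p : M, tangent p.

Definition vf_smooth_at (p : M) (X : vfield) :=
  forall f, smooth_at p f -> smooth_at p (fun q => X q f).

(* The bracket [X, Y] at [p], for [X], [Y] smooth near [p]. *)
Definition lie (X Y : vfield) : vfield := fun p =>
  mkT p (fun f => X p (fun q => Y q f) - Y p (fun q => X q f)).

(** ** Almost complex structures *)

Definition endo := forall p : M, {linear tangent p -> tangent p}.

Definition app (J : endo) (X : vfield) : vfield := fun p => J p (X p).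

Definition almost_complex (J : endo) :=
  (forall p xi, J p (J p xi) = - xi) /\
  (forall p X, vf_smooth_at p X -> vf_smooth_at p (app J X)).

Definition nijenhuis (J : endo) (X Y : vfield) : vfield := fun p =>
  lie (app J X) (app J Y) p - J p (lie (app J X) Y p)
  - J p (lie X (app J Y) p) - lie X Y p.

(** ** Connections *)

(* Covariant derivatives [D xi s] of sections of a family [V] of vector spaces
   over [M], for a given notion [sm p s] of smoothness of [s] near [p]. *)
Definition is_connection (V : M -> lmodType R)
    (sm : forall p : M, (forall q, V q) -> Prop)
    (D : forall p, tangent p -> (forall q, V q) -> V p) :=
  [/\ forall p (a : R) (xi eta : tangent p) s, sm p s ->
        D p (a *: xi + eta) s = a *: D p xi s + D p eta s,
      forall p (xi : tangent p) s t, sm p s -> sm p t ->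
        D p xi (fun q => s q + t q) = D p xi s + D p xi t,
      forall p (xi : tangent p) f s, smooth_at p f -> sm p s ->
        D p xi (fun q => f q *: s q) = xi f *: s p + f p *: D p xi s &
      forall p X s, vf_smooth_at p X -> sm p s ->
        sm p (fun q => D q (X q) s)].

Definition affine_connection
    (nabla : forall p, tangent p -> vfield -> tangent p) :=
  @is_connection (fun p => tangent p) vf_smooth_at nabla.

Definition minimal_connection (J : endo)
    (nabla : forall p, tangent p -> vfield -> tangent p) :=
  [/\ affine_connection nabla,
      forall p (xi : tangent p) Y, vf_smooth_at p Y ->
        nabla p xi (app J Y) = J p (nabla p xi Y) &
      forall p X Y, vf_smooth_at p X -> vf_smooth_at p Y ->
        nabla p (X p) Y - nabla p (Y p) X - lie X Y p
        = 4^-1 *: nijenhuis J X Y p].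

(** ** Curves and parallel vector fields along them *)

Definition curve_smooth_at (t : R) (c : R -> M) :=
  forall f, smooth_at (c t) f -> Cinf_at t (f \o c).

Definition velocity (c : R -> M) (t : R) : tangent (c t) :=
  mkT (c t) (fun f => derive1 (f \o c) t).

(* [W] is the covariant derivative at [t0] of the field [Z] along [c]:
   (sum_i f_i Y_i)' = sum_i f_i' Y_i + f_i nabla_{c'} Y_i. *)
Definition covariant_along (nabla : forall p, tangent p -> vfield -> tangent p)
    (c : R -> M) (Z : forall t, tangent (c t)) (t0 : R) (W : tangent (c t0)) :=
  exists (N : nat) (f : 'I_N -> R -> R) (Y : 'I_N -> vfield),
    [/\ forall i, vf_smooth_at (c t0) (Y i),
        forall i, derivable (f i) t0 1,
        \forall t \near t0, Z t = \sum_i f i t *: Y i (c t) &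
        W = \sum_i (derive1 (f i) t0 *: Y i (c t0)
                    + f i t0 *: nabla (c t0) (velocity c t0) (Y i))].

End Manifold.

Arguments tangent {R n} M p.
Arguments vfield {R n} M.
Arguments endo {R n} M.
Arguments mkT {R n M} p D.

Section Maps.
Context {R : realType} {n n' : nat} {M : manifold R n} {M' : manifold R n'}.

Definition map_smooth_at (p : M) (F : M -> M') :=
  forall g, smooth_at (F p) g -> smooth_at p (g \o F).

(* The differential of [F] at [p]; [q] is always used with [F p = q]
   propositionally, which spares casts. *)
Definition push (F : M -> M') {p : M} {q : M'} (xi : tangent M p) :
  tangent M' q := mkT q (fun g => xi (g \o F)).

End Maps.

(** * Vector bundles *)

(* Every fibre [fib x] is a vector space; [fibpt x v] is the vector [v] of
   [fib x] seen as a point of the total space [tot], and [fibvec a] is the point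
   [a] seen as a vector of its fibre. *)
Record vbundle (R : realType) (n k : nat) (L : manifold R n) := VBundle {
  tot :> manifold R (n + k);
  fib : L -> lmodType R;
  bproj : tot -> L;
  fibpt : forall x, fib x -> tot;
  fibvec : forall a, fib (bproj a);
  bproj_fibpt : forall x (v : fib x), bproj (fibpt v) = x;
  fibpt_fibvec : forall a, fibpt (fibvec a) = a;
  fibpt_inj : forall x, injective (@fibpt x);
  local_triviality : forall x : L,
    exists (c : chart R L n) (C : chart R tot (n + k)),
    [/\ atlas c, chart_dom c x, atlas C, chart_dom C = bproj @^-1` chart_dom c &
        forall y, chart_dom c y ->
          [/\ forall v : fib y, lsubmx (chart_coord C (fibpt v)) = chart_coord c y,
              linear (fun v : fib y => rsubmx (chart_coord C (fibpt v)) : 'rV[R]_k) &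
              bijective (fun v : fib y => rsubmx (chart_coord C (fibpt v)))]] }.

Section Bundle.
Context {R : realType} {n k : nat} {L : manifold R n} {E : vbundle k L}.

Definition bsection := forall x : L, fib E x.

Definition sec_smooth_at (x : L) (s : bsection) :=
  map_smooth_at x (fun y => fibpt (s y)).

Definition zsec (x : L) : E := fibpt (0 : fib E x).

(* The vertical vector [w], tangent to the fibre over [x] at the point [v];
   [a] is always used with [a = fibpt v] propositionally. *)
Definition vert {x : L} (v w : fib E x) {a : E} : tangent E a :=
  mkT a (fun f => derive1 (fun t : R => f (fibpt (v + t *: w))) 0).

Definition radial : vfield E := fun a => vert (fibvec a) (fibvec a).

Definition vert_lift (s : bsection) : vfield E :=
  fun a => vert (fibvec a) (s (bproj a)).

Definition linear_connection
    (D : forall x, tangent L x -> bsection -> fib E x) :=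
  @is_connection _ _ _ (fib E) sec_smooth_at D.

(* The horizontal lift of [xi] at the point [s x]; it depends on [s] only
   through that point. *)
Definition hlift (D : forall x, tangent L x -> bsection -> fib E x)
    (s : bsection) (x : L) (xi : tangent L x) : tangent E (fibpt (s x)) :=
  push (fun y => fibpt (s y)) xi - vert (s x) (D x xi s).

(** ** Pseudoholomorphic vector bundles *)

Definition PH_bundle (J : endo L) (Jh : endo E) :=
  [/\ almost_complex J, almost_complex Jh,
      forall a (xi : tangent E a),
        push (@bproj _ _ _ _ E) (Jh a xi)
        = J (bproj a) (push (@bproj _ _ _ _ E) xi),
      forall x, exists j : {linear fib E x -> fib E x}, forall v w : fib E x,
        Jh (fibpt v) (vert v w) = vert v (j w) &
      exists D, linear_connection D /\
        forall x s (xi : tangent L x), sec_smooth_at x s ->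
          hlift D s (J x xi) = Jh (fibpt (s x)) (hlift D s xi)].

Definition vertical {a : E} (xi : tangent E a) :=
  push (@bproj _ _ _ _ E) xi = 0 :> tangent L (bproj a).

Definition normally_integrable (Jh : endo E) :=
  forall a X Y, vf_smooth_at a X -> vf_smooth_at a Y -> vertical (X a) ->
    nijenhuis Jh X Y a = 0.

(* The two relations between [Jh] and [J0] are equivalent; either one may be
   used. *)
Definition normally_integrable_form (J : endo L) (Jh J0 : endo E) :=
  [/\ PH_bundle J J0, normally_integrable J0 &
      (forall a X, vf_smooth_at a X ->
         Jh a (X a) = J0 a (X a)
                      + 2^-1 *: J0 a (nijenhuis Jh radial X a)) \/
      (forall a X, vf_smooth_at a X ->
         J0 a (X a) = Jh a (X a)
                      - 2^-1 *: Jh a (nijenhuis Jh radial X a))].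

(** ** The NB-I structure of the zero section *)

Definition tangent_to_zsec {x : L} (eta : tangent E (zsec x)) :=
  exists xi : tangent L x, eta = push zsec xi.

Definition transport_preserves_zsec
    (nabla : forall a, tangent E a -> vfield E -> tangent E a) :=
  forall (c : R -> L) (Z : forall t, tangent E (zsec (c t))) (t0 t1 : R),
    t0 <= t1 ->
    (forall t, t0 <= t <= t1 -> curve_smooth_at t c) ->
    (forall t, t0 <= t <= t1 ->
       covariant_along nabla (c := zsec \o c) Z (t0 := t) 0) ->
    tangent_to_zsec (Z t0) -> tangent_to_zsec (Z t1).

(* The class of [eta] in the normal space T_xE / T_xL, which is identified with
   the fibre over [x]: a vector [w] of the fibre represents its class. *)
Definition normal_class {x : L} (eta : tangent E (zsec x)) : fib E x :=
  xget 0 [set w | exists xi : tangent L x, eta = push zsec xi + vert 0 w].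

(* The connection induced on the normal bundle: [nabla_xi s = [nabla_xi Y]] for
   any [Y] whose normal class along the zero section is [s]; the vertical lift
   of [s] is such a [Y], and the choice is immaterial when [nabla] preserves
   the tangent spaces of the zero section. *)
Definition normal_connection
    (nabla : forall a, tangent E a -> vfield E -> tangent E a)
    (x : L) (xi : tangent L x) (s : bsection) : fib E x :=
  normal_class (nabla (zsec x) (push zsec xi) (vert_lift s)).

(* [JN] is the direct sum of the complex structure of T_xL (the restriction of
   [Jh]) on horizontal spaces and of that of T_xE / T_xL (the quotient of [Jh])
   on vertical spaces. *)
Definition is_NBI (Jh : endo E)
    (nabla : forall a, tangent E a -> vfield E -> tangent E a) (JN : endo E) :=
  (forall x s (xi xi' : tangent L x), sec_smooth_at x s ->
     Jh (zsec x) (push zsec xi) = push zsec xi' ->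
     JN (fibpt (s x)) (hlift (normal_connection nabla) s xi)
     = hlift (normal_connection nabla) s xi') /\
  (forall x (v w : fib E x),
     JN (fibpt v) (vert v w) = vert v (normal_class (Jh (zsec x) (vert 0 w)))).

End Bundle.

(* Main.v *)
Require Import Defs.
From HB Require Import structures.
From mathcomp Require Import all_boot all_order all_algebra.
From mathcomp Require Import all_classical all_reals all_analysis.
From mathcomp Require Import ring.
Set Implicit Arguments.
Unset Strict Implicit.
Unset Printing Implicit Defensive.
Import Order.TTheory GRing.Theory Num.Theory.
Import numFieldNormedType.Exports.
Local Open Scope classical_set_scope.
Local Open Scope ring_scope.

(* Write D' for the connection induced by nabla on the normal bundle, S for the
   vertical lift of a section s, X for a field tangent to L along L, and N for
   the Nijenhuis tensor of Jh.  A structure agreeing with J on L and with a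
   constant structure j on each fibre is determined by its operator
   s |-> D_(J xi) s - j D_xi s, where D is any linear connection whose
   horizontal lifts are complex linear.  As the torsion of nabla is N / 4 and
   nabla Jh = 0, along L

     nabla_(Jh X) S - Jh nabla_X S = [Jh X, S] - Jh [X, S] - Jh N(X, S) / 2.

   As the radial field r vanishes on L and its derivative along S is S, and
   as J0 = Jh on L, the right-hand side is [J0 X, S] - J0 [X, S], whose normal
   part is the operator of J0.  So D' and the connection of J0 have the same
   operator, and J0 is the NB-I structure.  It is unique because every tangent
   space of E is spanned by horizontal lifts and vertical vectors; that tangent
   vectors, which are derivations, are determined by their values on coordinate
   functions is Hadamard's lemma. *)

(** * Smooth functions and the chain rule *)

Section Ck.
Context {R : realType} {V : normedModType R}.
Implicit Types (W : set V) (f g : V -> R) (k : nat).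

Lemma Ck_continuous W k f u : Ck_on W k f -> W u -> {for u, continuous f}.
Proof. by case: k => [|k] [cf _]; exact: cf. Qed.

Lemma Ck_derivable W k f u v : Ck_on W k.+1 f -> W u -> derivable f u v.
Proof. by move=> [_ /(_ v)[df _]]; exact: df. Qed.

Lemma Ck_derive W k f v : Ck_on W k.+1 f -> Ck_on W k ('D_v f).
Proof. by move=> [_ /(_ v)[]]. Qed.

Lemma CkS W k f : Ck_on W k.+1 f -> Ck_on W k f.
Proof.
elim: k f => [|k IH] f [cf df]; split=> // v.
by split; [exact: (df v).1|apply: IH; exact: (df v).2].
Qed.

Lemma Ck_sub W W' k f : W' `<=` W -> Ck_on W k f -> Ck_on W' k f.
Proof.
move=> WW'; elim: k f => [|k IH] f [cf df]; split=> //.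
- by move=> u /WW'; exact: cf.
- by move=> u /WW'; exact: cf.
- by move=> v; split; [move=> u /WW'; exact: (df v).1|apply: IH; exact: (df v).2].
Qed.

Lemma Ck_ext W k f g : open W -> (forall u, W u -> f u = g u) ->
  Ck_on W k f -> Ck_on W k g.
Proof.
move=> oW; elim: k f g => [|k IH] f g fg [cf df].
  split=> // u Wu; apply: cvg_trans (_ : f @ u --> g u).
    by apply: near_eq_cvg; apply: filterS (open_nbhs_nbhs (conj oW Wu)).
  by rewrite -fg//; exact: cf.
have nfg u : W u -> \forall w \near u, f w = g w.
  by move=> Wu; apply: filterS (open_nbhs_nbhs (conj oW Wu)).
split=> [u Wu|v]; last split=> [u Wu|].
- apply: cvg_trans (_ : f @ u --> g u); first exact/near_eq_cvg/nfg.
  by rewrite -fg//; exact: cf.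
- by apply: near_eq_derivable (nfg u Wu) _; exact: (df v).1.
- apply: IH (df v).2 => u Wu; exact: near_eq_derive (nfg u Wu).
Qed.

Lemma Ck_cst W k (a : R) : Ck_on W k (fun=> a).
Proof.
elim: k a => [|k IH] a; split=> //.
- by move=> u _; exact: cvg_cst.
- by move=> u _; exact: cvg_cst.
- move=> v; split=> [u _|]; first exact: derivable_cst.
  by rewrite (_ : 'D_v _ = fun=> 0)//; apply/funext => u; exact: derive_cst.
Qed.

Lemma CkD W k f g : open W -> Ck_on W k f -> Ck_on W k g ->
  Ck_on W k (fun u => f u + g u).
Proof.
move=> oW; elim: k f g => [|k IH] f g [cf df] [cg dg].
  by split=> // u Wu; exact: (cvgD (cf _ Wu) (cg _ Wu)).
split=> [u Wu|v]; last split=> [u Wu|].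
- exact: (cvgD (cf _ Wu) (cg _ Wu)).
- exact: derivableD ((df v).1 _ Wu) ((dg v).1 _ Wu).
- apply: Ck_ext (IH _ _ (df v).2 (dg v).2) => // u Wu.
  by rewrite -deriveD//; [exact: (df v).1|exact: (dg v).1].
Qed.

Lemma CkM W k f g : open W -> Ck_on W k f -> Ck_on W k g ->
  Ck_on W k (fun u => f u * g u).
Proof.
move=> oW; elim: k f g => [|k IH] f g Cf Cg.
  by split=> // u Wu; exact: (cvgM (Ck_continuous Cf Wu) (Ck_continuous Cg Wu)).
split=> [u Wu|v]; last split=> [u Wu|].
- exact: (cvgM (Ck_continuous Cf Wu) (Ck_continuous Cg Wu)).
- exact: (derivableM (Ck_derivable Cf Wu) (Ck_derivable Cg Wu)).
- pose h u := f u * 'D_v g u + g u * 'D_v f u.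
  apply: (@Ck_ext W k h) => //.
    by move=> u Wu; rewrite /h -(deriveM (Ck_derivable Cf Wu) (Ck_derivable Cg Wu)).
  by apply: CkD => //; apply: IH; (apply: Ck_derive || apply: CkS) => //.
Qed.

Lemma Ck_sum W k m (f : 'I_m -> V -> R) : open W ->
  (forall i, Ck_on W k (f i)) -> Ck_on W k (fun u => \sum_i f i u).
Proof.
move=> oW; elim: m f => [|m IH] f Cf.
  by rewrite (_ : (fun _ => _) = fun=> 0); [exact: Ck_cst|apply/funext => u; rewrite big_ord0].
rewrite (_ : (fun _ => _) = fun u => f ord0 u + \sum_i f (lift ord0 i) u).
  by apply: CkD => //; apply: IH.
by apply/funext => u; rewrite big_ord_recl.
Qed.

End Ck.

Section Line.
Context {R : realType} {V : normedModType R}.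
Implicit Types (f : V -> R) (x v : V).

(** With [y] the point reached at [t], the map [s |-> f (s *: v + y)] has at 0 the directional
    derivative by definition; the rest is composition with the affine map [s |-> (s - t) * a]. *)
Lemma is_derive_line f x v (a t : R) : derivable f (x + (t * a) *: v) v ->
  is_derive t 1 (fun s => f (x + (s * a) *: v)) (a * 'D_v f (x + (t * a) *: v)).
Proof.
set y := x + _ => dfy; pose psi (s : R) := f (s *: v + y).
have dpsi : is_derive (0 : R) 1 psi ('D_v f y).
  apply: DeriveDef; first exact: (derivable1P f y v).1.
  rewrite /derive (_ : (fun h => _) = fun h => h^-1 *: ((f \o shift y) (h *: v) - f y))//.
  by apply/funext => h /=; rewrite /psi addr0 scale0r add0r [h%:A]mulr1.
rewrite (_ : (fun s => _) = psi \o (fun s => (s - t) * a)); last first.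
  apply/funext => s /=; rewrite /psi /y; congr f.
  by rewrite mulrBl scalerBl addrCA subrK addrC.
have dg : is_derive t 1 (fun s : R => (s - t) * a) a.
  have H : is_derive t 1 (fun s : R => (s - t)) 1 by apply: is_derive_eq; rewrite subr0.
  rewrite (_ : (fun s : R => _) = a *: (fun s : R => s - t)); last first.
    by apply/funext => s; rewrite mulrC.
  by apply: is_derive_eq; rewrite [_ *: _]mulr1.
have g0 : (t - t) * a = 0 by rewrite subrr mul0r.
case: dpsi dg => dpsi dpsiE [dg dgE].
have dpsi' : derivable psi ((t - t) * a) 1 by rewrite g0.
apply: DeriveDef.
  by apply/derivable1_diffP; apply: differentiable_comp; apply/derivable1_diffP.
by rewrite -derive1E derive1_comp// g0 !derive1E dpsiE dgE mulrC.
Qed.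

Lemma mvt_line f x v (a : R) :
    (forall t : R, 0 <= t <= 1 -> derivable f (x + (t * a) *: v) v) ->
  exists2 t : R, 0 <= t <= 1 &
    f (x + a *: v) - f x = a * 'D_v f (x + (t * a) *: v).
Proof.
move=> df; pose phi t := f (x + (t * a) *: v).
have dphi (t : R) : 0 <= t <= 1 -> is_derive t 1 phi (a * 'D_v f (x + (t * a) *: v)).
  by move=> t01; apply: is_derive_line; exact: df.
have [|||t] := @MVT_segment R phi (fun t => a * 'D_v f (x + (t * a) *: v)) 0 1.
- exact: ler01.
- by move=> t /[!in_itv]/= /andP[t0 t1]; apply: dphi; rewrite !ltW.
- apply: derivable_within_continuous => t /[!in_itv]/= t01.
  by case: (dphi t t01).
- rewrite in_itv/= /phi mul1r mul0r scale0r addr0 subr0 mulr1 => t01 E.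
  by exists t.
Qed.

End Line.

(** * The chain rule for maps into row vectors *)

Section Chain.
Context {R : realType}.

Lemma rV_ballP m (u w : 'rV[R]_m) (r : R) : 0 < r ->
  ball u r w <-> forall i, `|u 0 i - w 0 i| < r.
Proof.
move=> r0; split=> [[_ b] i|b].
  by have := b 0 i; rewrite -ball_normE.
by split=> // i j; rewrite (ord1 i); rewrite -ball_normE/=; exact: b.
Qed.

(* [G i] is the difference quotient of [F] along the [i]-th edge of a path from
   [u] to [w] parallel to the axes. *)
Lemma caratheodory m (W : set 'rV[R]_m) (F : 'rV[R]_m -> R) u :
    open W -> W u -> Ck_on W 1 F ->
  exists2 G : 'I_m -> 'rV[R]_m -> R,
    forall i, G i @ u --> 'D_(delta_mx 0 i) F u &
    forall w, F w - F u = \sum_i (w 0 i - u 0 i) * G i w.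
Proof.
move=> oW Wu CF.
(* The vertices of the path: coordinates below [i] come from [w], the others from [u]. *)
pose mix (i : nat) (w : 'rV[R]_m) : 'rV[R]_m := \row_j if (j < i)%N then w 0 j else u 0 j.
have mixS (i : 'I_m) w : mix i.+1 w = mix i w + (w 0 i - u 0 i) *: delta_mx 0 i.
  apply/rowP => j; rewrite !mxE ltnS eqxx/=; case: (ltngtP j i) => ij.
  - by rewrite (_ : j == i = false) ?mulr0 ?addr0// -val_eqE/= ltn_eqF.
  - by rewrite (_ : j == i = false) ?mulr0 ?addr0// -val_eqE/= gtn_eqF.
  - by have -> : j = i by [exact: val_inj]; rewrite eqxx mulr1 addrC subrK.
(* Where the [i]-th coordinate does not move the quotient would be 0/0, and the expected limit is
   put there instead. *)
pose G (i : 'I_m) (w : 'rV[R]_m) := if w 0 i == u 0 i then 'D_(delta_mx 0 i) F u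
  else (F (mix i.+1 w) - F (mix i w)) / (w 0 i - u 0 i).
exists G => [i|w]; last first.
  have -> : F w - F u = \sum_(0 <= i < m) (F (mix i.+1 w) - F (mix i w)).
    rewrite telescope_sumr//; congr (F _ - F _); apply/rowP => j; rewrite !mxE//.
    by rewrite ltn_ord.
  rewrite big_mkord; apply: eq_bigr => i _; rewrite /G; case: eqVneq => wu.
    by rewrite mixS wu subrr scale0r addr0 mul0r subrr.
  by rewrite mulrC divfK// subr_eq0.
apply/(@cvgrPdist_le R R _ (nbhs u) (nbhs_filter u)) => e e0.
have := Ck_continuous (Ck_derive (delta_mx 0 i) CF) Wu.
move/cvgrPdist_le => /(_ e e0) Fe.
have : \forall w \near u, W w /\ `|'D_(delta_mx 0 i) F u - 'D_(delta_mx 0 i) F w| <= e.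
  by apply: filterS2 (open_nbhs_nbhs (conj oW Wu)) Fe.
move=> /nbhs_ballP[r /= r0 B].
apply/nbhs_ballP; exists r => //= w bw; rewrite /G; case: eqVneq => wu.
  by rewrite subrr normr0 ltW.
(* The norm is the sup norm, so every edge of the path stays in any ball about [u] that contains
   [w]. *)
have inball (t : R) : 0 <= t <= 1 -> ball u r (mix i w + (t * (w 0 i - u 0 i)) *: delta_mx 0 i).
  move=> /andP[t0 t1]; apply/rV_ballP => // j; rewrite !mxE eqxx/=.
  have /(_ j) bwj := (rV_ballP u w r0).1 bw.
  case: (ltngtP j i) => ij.
  - by rewrite (_ : j == i = false) ?mulr0 ?addr0// -val_eqE/= ltn_eqF.
  - by rewrite (_ : j == i = false) ?mulr0 ?addr0 ?subrr ?normr0// -val_eqE/= gtn_eqF.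
  - have <- : j = i by [exact: val_inj].
    rewrite eqxx mulr1 opprD addNKr normrN normrM.
    by rewrite (ger0_norm t0) (le_lt_trans _ bwj)// distrC ler_piMl.
have [|t t01 E] := @mvt_line R _ F (mix i w) (delta_mx 0 i) (w 0 i - u 0 i).
  by move=> t t01; apply: Ck_derivable CF _; exact: (B _ (inball _ t01)).1.
rewrite mixS E mulrC mulKf ?subr_eq0//; exact: (B _ (inball _ t01)).2.
Qed.

(** By [caratheodory] the difference quotient of [F \o h] is a finite sum of difference quotients of
    the coordinates of [h] times functions continuous at [h x], so the limit is taken term by
    term. *)
Lemma is_derive_comp_rV (V : normedModType R) m (W : set 'rV[R]_m)
    (F : 'rV[R]_m -> R) (h : V -> 'rV[R]_m) x v :
  open W -> W (h x) -> Ck_on W 1 F ->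
  (forall i, derivable (fun y => h y 0 i) x v) ->
  is_derive x v (F \o h)
    (\sum_i 'D_v (fun y => h y 0 i) x * 'D_(delta_mx 0 i) F (h x)).
Proof.
move=> oW Wx CF dh; have [G cG FG] := caratheodory oW Wx CF.
have chline : h (t *: v + x) @[t --> (0 : R)^'] --> h x.
  have dhx : derivable h x v by apply/derivable_mxP => i j; rewrite (ord1 i); exact: dh.
  have /derivable1_diffP/differentiable_continuous := (derivable1P h x v).1 dhx.
  by move=> /continuous_withinNx; rewrite scale0r add0r.
have cv : (fun t => t^-1 *: ((F \o h \o shift x) (t *: v) - (F \o h) x)) @ 0^' -->
    (\sum_i 'D_v (fun y => h y 0 i) x * 'D_(delta_mx 0 i) F (h x)).
  rewrite (_ : (fun t => _) = fun t =>
      \sum_i (t^-1 *: (h (t *: v + x) 0 i - h x 0 i)) * G i (h (t *: v + x))); last first.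
    apply/funext => t /=; rewrite FG scaler_sumr; apply: eq_bigr => i _.
    by rewrite -scalerAl.
  apply: cvg_big => [|i _]; first exact: add_continuous.
  apply: cvgM; first exact: dh.
  exact: cvg_comp chline (cG i).
apply: DeriveDef; first by apply/cvg_ex; eexists; exact: cv.
exact: cvg_lim cv.
Qed.

(** Induction on [k] with [F] general: the chain rule writes a derivative of [F \o h] as a sum of
    products of derivatives of [h] with partial derivatives of [F] composed with [h]. *)
Lemma Ck_comp (V : normedModType R) m k (W : set V) (W' : set 'rV[R]_m)
    (F : 'rV[R]_m -> R) (h : V -> 'rV[R]_m) :
  open W -> open W' -> (forall x, W x -> W' (h x)) -> Ck_on W' k F ->
  (forall i, Ck_on W k (fun y => h y 0 i)) -> Ck_on W k (F \o h).
Proof.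
move=> oW oW' WW'.
have ch x : (forall i, {for x, continuous (fun y => h y 0 i)}) -> {for x, continuous h}.
  move=> chi; apply/cvgrPdist_le => /= e e0.
  have : \forall y \near x, forall i, `|h x 0 i - h y 0 i| <= e.
    by apply: filter_forall => i; move/cvgrPdist_le: (chi i); exact.
  apply: filterS => y H; rewrite [leLHS]/Num.Def.normr/= mx_normrE.
  by apply: bigmax_le => [|[i j] _]; [exact: ltW|rewrite !mxE (ord1 i)/=].
have cFh x k' (G : _ -> R) : W x -> Ck_on W' k' G -> (forall i, Ck_on W k' (fun y => h y 0 i)) ->
    {for x, continuous (G \o h)}.
  move=> Wx CG Ch; apply: continuous_comp; last exact: Ck_continuous CG (WW' _ Wx).
  by apply: ch => i; exact: Ck_continuous (Ch i) Wx.
elim: k F => [|k IH] F CF Ch; first by split=> // x Wx; exact: cFh CF Ch.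
have CF1 : Ck_on W' 1 F.
  by case: CF => cF dF; split=> // v; split; [exact: (dF v).1|split=> // y Wy; exact: Ck_continuous (dF v).2 Wy].
have D x v : W x -> is_derive x v (F \o h)
    (\sum_i 'D_v (fun y => h y 0 i) x * 'D_(delta_mx 0 i) F (h x)).
  by move=> Wx; apply: is_derive_comp_rV oW' (WW' _ Wx) CF1 _ => i; exact: Ck_derivable (Ch i) Wx.
split=> [x Wx|v]; first exact: cFh CF Ch.
split=> [x Wx|]; first exact: (@ex_derive _ _ _ _ _ _ _ (D x v Wx)).
apply: (@Ck_ext _ _ W k (fun x => \sum_i 'D_v (fun y => h y 0 i) x * ('D_(delta_mx 0 i) F \o h) x)) => //.
  by move=> x Wx; rewrite (@derive_val _ _ _ _ _ _ _ (D x v Wx)).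
apply: Ck_sum => // i; apply: CkM => //; first exact: Ck_derive.
apply: IH; first exact: Ck_derive.
by move=> j; exact: CkS.
Qed.

Lemma is_derive_coord m (u v : 'rV[R]_m) i :
  is_derive u v (fun w : 'rV[R]_m => w 0 i) (v 0 i).
Proof.
have dl : differentiable (fun y : 'rV[R]_m => y 0 i) u by exact: differentiable_coord.
apply: DeriveDef; first exact: diff_derivable.
apply: cvg_lim => //; apply: cvg_near_cst; near=> t.
rewrite /= !mxE addrK [_ *: _]mulKf//; near: t; exact: nbhs_dnbhs_neq.
Unshelve. all: by end_near. Qed.

Lemma is_derive_rVE m (W : set 'rV[R]_m) (F : 'rV[R]_m -> R) u v :
  open W -> W u -> Ck_on W 1 F ->
  is_derive u v F (\sum_i v 0 i * 'D_(delta_mx 0 i) F u).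
Proof.
move=> oW Wu CF.
have H := is_derive_coord u v.
have := @is_derive_comp_rV _ m W F id u v oW Wu CF (fun i => @ex_derive _ _ _ _ _ _ _ (H i)).
by under eq_bigr do rewrite (@derive_val _ _ _ _ _ _ _ (H _)).
Qed.

End Chain.

(** * Hadamard's lemma *)

Section UnitIntegral.
Context {R : realType}.
Local Notation mu := (@lebesgue_measure R).
Implicit Types f g : R -> R.

Definition int01 f : R := \int[mu]_(t in `[0, 1]) f t.

Definition continuous01 f := forall t : R, 0 <= t <= 1 -> {for t, continuous f}.

Lemma continuous01_within f : continuous01 f -> {within `[0, 1], continuous f}.
Proof.
move=> cf; apply/continuous_in_subspaceT => t /set_mem/=.
by rewrite in_itv/=; exact: cf.
Qed.

Lemma continuous01_integrable f :
  continuous01 f -> mu.-integrable `[0, 1] (EFin \o f).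
Proof.
move=> /continuous01_within cf; apply: continuous_compact_integrable => //.
exact: segment_compact.
Qed.

Lemma int01_lin f g (a : R) : continuous01 f -> continuous01 g ->
  int01 (fun t => a * f t + g t) = a * int01 f + int01 g.
Proof.
move=> cf cg; have caf : continuous01 (fun t => a * f t).
  by move=> t t01; apply: cvgM; [exact: cvg_cst|exact: cf].
rewrite /int01 RintegralD//; try exact: continuous01_integrable.
by rewrite RintegralZl//; exact: continuous01_integrable.
Qed.

Lemma int01_bound f (e : R) : continuous01 f ->
  (forall t : R, 0 <= t <= 1 -> `|f t| <= e) -> `|int01 f| <= e.
Proof.
move=> cf fe.
have ci := continuous01_integrable cf.
apply: (le_trans (le_normr_Rintegral _ ci)) => //.
apply: (@le_trans _ _ (\int[mu]_(t in `[0, 1]) e)); last first.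
  rewrite Rintegral_cst//= lebesgue_measure_itv/= lte01 oppr0 adde0/=.
  by rewrite mulr1.
have ce : continuous01 (fun=> e) by move=> t _; exact: cvg_cst.
apply: le_Rintegral => //.
- exact: integrable_norm.
- exact: continuous01_integrable ce.
Qed.

Lemma int01_sum m (c : 'I_m -> R) (f : 'I_m -> R -> R) :
    (forall i, continuous01 (f i)) ->
  int01 (fun t => \sum_i c i * f i t) = \sum_i c i * int01 (f i).
Proof.
elim: m c f => [|m IH] c f cf.
  rewrite (_ : (fun _ => _) = fun=> 0); last by apply/funext => t; rewrite big_ord0.
  by rewrite big_ord0 /int01 Rintegral_cst//= mul0r.
rewrite (_ : (fun _ => _) = fun t => c ord0 * f ord0 t +
    \sum_i c (lift ord0 i) * f (lift ord0 i) t); last first.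
  by apply/funext => t; rewrite big_ord_recl.
rewrite int01_lin//; first by rewrite IH// big_ord_recl.
move=> t t01; apply: cvg_big => [|i _]; first exact: add_continuous.
by apply: cvgM; [exact: cvg_cst|exact: cf].
Qed.

Lemma int01_FTC f F : continuous01 f ->
  (forall t : R, 0 <= t <= 1 -> is_derive t 1 F (f t)) -> int01 f = F 1 - F 0.
Proof.
move=> cf dF.
have cF t : 0 <= t <= 1 -> {for t, continuous F}.
  move=> t01; apply/differentiable_continuous/derivable1_diffP.
  by case: (dF t t01).
rewrite /int01 /Rintegral (@continuous_FTC2 R f F 0 1)//.
- exact: continuous01_within.
- split.
  + move=> t; rewrite in_itv/= => /andP[t0 t1].
    by have [] := dF t; rewrite ?ltW.
  + by apply: cvg_at_right_filter; apply: cF; rewrite lexx ler01.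
  + by apply: cvg_at_left_filter; apply: cF; rewrite lexx ler01.
- move=> t; rewrite in_itv/= => /andP[t0 t1].
  have [|_ <-] := dF t; first by rewrite !ltW.
  by rewrite derive1E.
Qed.

End UnitIntegral.

(** * Averages over the segments issued from a centre *)

Section Star.
Context {R : realType} {V : normedModType R} (u : V) (r : R).
Implicit Types (g : V -> R) (w v : V).

Local Notation B := (ball u r).
Local Notation P t w := (u + t *: (w - u)).

Lemma star_ball (t : R) w : 0 <= t <= 1 -> B w -> B (P t w).
Proof.
move=> /andP[t0 t1]; rewrite -ball_normE/= opprD addNKr normrN normrZ.
by rewrite ger0_norm// distrC => /(le_lt_trans _); apply; rewrite ler_piMl.
Qed.

Lemma star_continuous (t : R) w :
  {for (t, w), continuous (fun sz : R * V => P sz.1 sz.2)}.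
Proof.
apply: cvgD; first exact: cvg_cst.
apply: cvgZ; first exact: cvg_fst.
by apply: cvgB; [exact: cvg_snd|exact: cvg_cst].
Qed.

(* The weight [t ^+ k] makes this family closed under differentiation, which
   reduces its smoothness to its continuity. *)
Definition star (k : nat) g w := int01 (fun t => t ^+ k * g (P t w)).

Lemma star_integrand k g w : (forall z, B z -> {for z, continuous g}) -> B w ->
  continuous01 (fun t => t ^+ k * g (P t w)).
Proof.
move=> cg Bw t t01; apply: cvgM; first exact: exprn_continuous.
have : {for t, continuous (fun s : R => P s w)}.
  apply: cvgD; first exact: cvg_cst.
  by apply: cvgZr_tmp; exact: cvg_id.
by move/continuous_comp; apply; apply: cg; exact: star_ball.
Qed.

(** Compactness of [[0, 1]] makes the continuity of [g] at the points [P t w] uniform in [t], as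
    limits under the integral require. *)
Lemma star_tube g w (e : R) : (forall z, B z -> {for z, continuous g}) -> B w ->
  0 < e -> \forall z \near w, B z /\
    forall t : R, 0 <= t <= 1 -> `|g (P t w) - g (P t z)| <= e.
Proof.
move=> cg Bw e0; have oB : open B by exact: ball_open.
have c01 : compact (`[0, 1]%classic : set R) by exact: segment_compact.
have : \forall z \near w, `[0, 1] `<=` (fun t : R => `|g (P t w) - g (P t z)| <= e).
  apply: ((compact_near_coveringP _).1 c01 V (nbhs w)) => t; rewrite /= in_itv/= => t01.
  have gP : {for (t, w), continuous (fun sz : R * V => g (P sz.1 sz.2))}.
    apply: continuous_comp; first exact: star_continuous.
    by apply: cg; exact: star_ball.
  (* Both values in the bound move with the parameter, so each is compared with [g (P t w)] at the
     fixed [t]. *)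
  have e20 : 0 < e / 2 by rewrite divr_gt0.
  have H1 : \forall sz \near (nbhs t, nbhs w), `|g (P t w) - g (P sz.1 sz.2)| <= e / 2.
    by move/cvgrPdist_le: gP => /(_ _ e20).
  have H2 : \forall s \near t, `|g (P t w) - g (P s w)| <= e / 2.
    have : {for t, continuous (fun s : R => g (P s w))}.
      apply: continuous_comp; last by apply: cg; exact: star_ball.
      apply: cvgD; first exact: cvg_cst.
      by apply: cvgZr_tmp; exact: cvg_id.
    by move/cvgrPdist_le => /(_ _ e20).
  have H3 : \forall sz \near (nbhs t, nbhs w), `|g (P t w) - g (P sz.1 w)| <= e / 2.
    exists ([set s | `|g (P t w) - g (P s w)| <= e / 2], setT).
      by split => //=; exact: filterT.
    by move=> [s z] [].
  near=> sz.
  rewrite (le_trans (ler_distD (g (P t w)) _ _))// [leRHS]splitr lerD//.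
    by rewrite distrC; near: sz.
  by near: sz.
move=> tube; near=> z; split.
  by near: z; exact: (open_nbhs_nbhs (conj oB Bw)).
by move=> t t01; apply: (near tube z) => //=; rewrite in_itv.
Unshelve. all: by end_near. Qed.

Lemma star_cont k g w : (forall z, B z -> {for z, continuous g}) -> B w ->
  {for w, continuous (star k g)}.
Proof.
move=> cg Bw; apply/cvgrPdist_le => e e0.
apply: filterS (star_tube cg Bw e0) => z [Bz H].
have I z0 (Bz0 : B z0) := @star_integrand k _ _ cg Bz0.
have -> : star k g w - star k g z =
    int01 (fun t => -1 * (t ^+ k * g (P t z)) + t ^+ k * g (P t w)).
  by rewrite (int01_lin _ (I _ Bz) (I _ Bw)) mulN1r addrC.
apply: int01_bound => [t t01|t t01].
  apply: cvgD; last exact: (I _ Bw t t01).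
  by apply: cvgM; [exact: cvg_cst|exact: (I _ Bz t t01)].
rewrite mulN1r addrC -mulrBr normrM (le_trans _ (H t t01))// ler_piMl//.
by case/andP: t01 => t0 t1; rewrite normrX ger0_norm// exprn_ile1// t0.
Qed.

(** Differentiation under the integral: the mean value theorem turns the difference quotient of
    [g (P t w)] into [t] times ['D_v g] at an intermediate point, and [star_tube] bounds the error
    uniformly in [t]. The factor [t] raises the weight by one. *)
Lemma is_derive_star k g w v : Ck_on B 1 g -> B w ->
  is_derive w v (star k g) (star k.+1 ('D_v g) w).
Proof.
move=> Cg Bw; have cg z : B z -> {for z, continuous g} by move=> Bz; exact: Ck_continuous Cg Bz.
have cdg z : B z -> {for z, continuous ('D_v g)}.
  by move=> Bz; exact: Ck_continuous (Ck_derive v Cg) Bz.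
suff cv : (fun h => h^-1 *: ((star k g \o shift w) (h *: v) - star k g w)) @ (0 : R)^'
    --> star k.+1 ('D_v g) w.
  by apply: DeriveDef; [apply/cvg_ex; eexists; exact: cv|exact: cvg_lim cv].
apply/cvgrPdist_le => e e0.
have := star_tube cdg Bw e0; move=> /nbhs_ballP[d /= d0 H].
near=> h.
have h0 : h != 0 by near: h; exact: nbhs_dnbhs_neq.
(* The radius is divided by this number, which stays positive when [v] is zero. *)
have v1 : 0 < 1 + `|v| by rewrite ltr_pwDl.
have hd : `|h| < d / (1 + `|v|) by near: h; apply: dnbhs0_lt; rewrite divr_gt0// ltr_pwDl.
have hball (th : R) : 0 <= th <= 1 -> ball w d (w + (th * h) *: v).
  move=> /andP[th0 th1]; rewrite -ball_normE/= opprD addNKr normrN normrZ normrM ger0_norm//.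
  rewrite -mulrA (@le_lt_trans _ _ (`|h| * `|v|))//.
    by rewrite ler_piMl// mulr_ge0.
  rewrite (@le_lt_trans _ _ (`|h| * (1 + `|v|)))// ?ler_wpM2l// ?lerDr//.
  by rewrite -ltr_pdivlMr.
have Bh : B (h *: v + w).
  have h11 : 0 <= (1 : R) <= 1 by rewrite ler01 lexx.
  have [+ _] := H _ (hball _ h11).
  by rewrite mul1r [_ + w]addrC.
have I z0 (Bz0 : B z0) := @star_integrand k _ _ cg Bz0; have I' := @star_integrand k.+1 _ _ cdg Bw.
have -> : star k.+1 ('D_v g) w - h^-1 *: ((star k g \o shift w) (h *: v) - star k g w) =
    int01 (fun t => - h^-1 * (t ^+ k * g (P t (h *: v + w)))
       + (h^-1 * (t ^+ k * g (P t w)) + t ^+ k.+1 * 'D_v g (P t w))).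
  rewrite (int01_lin _ (I _ Bh)) ?(int01_lin _ (I _ Bw) I').
    by rewrite /star /= [_ *: _]mulrBr; ring.
  move=> t t01; apply: cvgD; last exact: (I' t t01).
  by apply: cvgM; [exact: cvg_cst|exact: (I _ Bw t t01)].
apply: int01_bound => [t t01|t t01].
  apply: cvgD; last apply: cvgD; last exact: (I' t t01).
  - by apply: cvgM; [exact: cvg_cst|exact: (I _ Bh t t01)].
  - by apply: cvgM; [exact: cvg_cst|exact: (I _ Bw t t01)].
have PE (th : R) : P t w + (th * (t * h)) *: v = P t (w + (th * h) *: v).
  by rewrite -addrA [w + _ - u]addrAC [in RHS]scalerDr scalerA mulrCA.
have t1B (th : R) : 0 <= th <= 1 -> B (P t w + (th * (t * h)) *: v).
  by move=> th01; rewrite PE; apply: star_ball => //; exact: (H _ (hball _ th01)).1.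
have [|th th01 E] := @mvt_line R V g (P t w) v (t * h).
  by move=> th th01; exact: Ck_derivable Cg (t1B _ th01).
have := PE 1; rewrite !mul1r [w + h *: v]addrC => PE1.
rewrite -PE1 -(subrK (g (P t w)) (g (P t w + (t * h) *: v))) E PE.
set D' := 'D_v g (P t (w + _)); set D := 'D_v g (P t w).
rewrite [X in `|X|](_ : _ = t ^+ k.+1 * (D - D')); last by rewrite exprS; field.
rewrite normrM (le_trans _ ((H _ (hball _ th01)).2 t t01))// ler_piMl//.
by case/andP: t01 => t0 t1; rewrite normrX ger0_norm// exprn_ile1// t0.
Unshelve. all: by end_near. Qed.

Lemma Ck_star k j g : Ck_on B j g -> Ck_on B j (star k g).
Proof.
have oB : open B by exact: ball_open.
elim: j k g => [|j IH] k g Cg.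
  by split=> // w Bw; apply: star_cont => // z Bz; exact: Ck_continuous Cg Bz.
have Cg1 : Ck_on B 1 g.
  case: Cg => cg dg; split=> // v; split; first exact: (dg v).1.
  by split=> // z Bz; exact: Ck_continuous (dg v).2 Bz.
split=> [w Bw|v].
  by apply: star_cont => // z Bz; exact: Ck_continuous Cg Bz.
split=> [w Bw|]; first by case: (is_derive_star k v Cg1 Bw).
apply: (Ck_ext oB _ (IH k.+1 _ (Ck_derive v Cg))) => w Bw.
by case: (is_derive_star k v Cg1 Bw).
Qed.

End Star.

(** The coefficients are averages of the partial derivatives over the segment from [u] to [w], that
    is [star] with weight [t ^+ 0]; integrating the derivative of [F] along that segment gives the
    expansion. *)
Lemma hadamard (R : realType) m (F : 'rV[R]_m -> R) u (r : R) :
    0 < r -> Cinf_on (ball u r) F ->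
  exists G : 'I_m -> 'rV[R]_m -> R,
  [/\ forall i, Cinf_on (ball u r) (G i),
      forall i, G i u = 'D_(delta_mx 0 i) F u &
      forall w, ball u r w -> F w = F u + \sum_i (w 0 i - u 0 i) * G i w].
Proof.
move=> r0 CF; have oB : open (ball u r) by exact: ball_open.
exists (fun i => star u 0 ('D_(delta_mx 0 i) F)); split=> [i k|i|w Bw].
- exact/Ck_star/Ck_derive.
- rewrite /star (_ : (fun t => _) = fun=> 'D_(delta_mx 0 i) F u).
    rewrite /int01 Rintegral_cst//= lebesgue_measure_itv/= lte01 oppr0 adde0/=.
    by rewrite mulr1.
  by apply/funext => t; rewrite subrr scaler0 addr0 expr0 mul1r.
have ci i : continuous01 (fun t => t ^+ 0 * 'D_(delta_mx 0 i) F (u + t *: (w - u))).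
  exact: (@star_integrand R _ u r 0 _ w (fun z Bz => Ck_continuous (Ck_derive _ (CF 1)) Bz) Bw).
rewrite /star -int01_sum//.
have cs : continuous01 (fun t => \sum_i (w 0 i - u 0 i) *
    (t ^+ 0 * 'D_(delta_mx 0 i) F (u + t *: (w - u)))).
  move=> t t01; apply: cvg_big => [|i _]; first exact: add_continuous.
  by apply: cvgM; [exact: cvg_cst|exact: (ci i t t01)].
have /(int01_FTC cs) -> : forall t : R, 0 <= t <= 1 ->
    is_derive t 1 (fun t => F (u + t *: (w - u)))
      (\sum_i (w 0 i - u 0 i) * (t ^+ 0 * 'D_(delta_mx 0 i) F (u + t *: (w - u)))); last first.
  by rewrite scale1r scale0r addr0 addrCA subrr addr0 addrC subrK.
move=> t t01; have BP : ball u r (u + t *: (w - u)) by exact: star_ball.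
have : derivable F (u + (t * 1) *: (w - u)) (w - u).
  by rewrite mulr1; exact: Ck_derivable (CF 1) BP.
move=> /is_derive_line[].
rewrite mulr1 mul1r (_ : (fun s => _) = fun t => F (u + t *: (w - u))); last first.
  by apply/funext => s; rewrite mulr1.
move=> D1 D2; apply: DeriveDef => //; rewrite D2.
have [_ ->] := is_derive_rVE (w - u) oB BP (CF 1).
by apply: eq_bigr => i _; rewrite !mxE expr0 mul1r.
Qed.

(** * Tangent vectors in coordinates *)

Section SmoothFunctions.
Context {R : realType} {n : nat} {M : manifold R n}.
Implicit Types (p q : M) (f g : M -> R) (c : chart R M n).

Lemma open_point_preimage c (U : set M) : open U ->
  open [set u | chart_img c u /\ U (chart_point c u)].
Proof.
move=> oU; rewrite openE => u [cu Uu].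
have nU : nbhs (chart_point c u) U by exact: open_nbhs_nbhs.
have nV : nbhs u (chart_point c @^-1` U) by exact: (@point_cont _ _ _ c u cu U nU).
have nI : nbhs u (chart_img c) := open_nbhs_nbhs (conj (@open_img _ _ _ c) cu).
by apply: filterS2 nI nV.
Qed.

Lemma near_dom c p : chart_dom c p -> \forall q \near p, chart_dom c q.
Proof. by move=> cp; exact: open_nbhs_nbhs (conj (open_dom c) cp). Qed.

Lemma smooth_at_nbhs p f (A : set M) : nbhs p A ->
  (forall c, atlas c ->
    Cinf_on [set u | chart_img c u /\ A° (chart_point c u)] (f \o chart_point c)) ->
  smooth_at p f.
Proof. by move=> pA H; exists (A°); split=> //; exact: open_interior. Qed.

Lemma smooth_at_ext p f g : (\forall q \near p, f q = g q) ->
  smooth_at p f -> smooth_at p g.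
Proof.
move=> fg [U [oU Up CU]].
have UA : nbhs p [set q | U q /\ f q = g q].
  by apply: filterS2 (open_nbhs_nbhs (conj oU Up)) fg.
apply: (smooth_at_nbhs UA) => c ac k.
have CU' := Ck_sub _ (CU c ac k).
apply: Ck_ext (CU' _ _).
- exact: open_point_preimage (open_interior _).
- by move=> u [_ /interior_subset[]].
- by move=> u [cu /interior_subset[]].
Qed.

Lemma near_smooth_at p f : smooth_at p f -> \forall q \near p, smooth_at q f.
Proof.
move=> [U [oU Up CU]]; apply: filterS (open_nbhs_nbhs (conj oU Up)) => q Uq.
by exists U.
Qed.

Lemma smooth_at_cst p (a : R) : smooth_at p (fun=> a).
Proof. by exists setT; split=> [|//|c _ k]; [exact: openT|exact: Ck_cst]. Qed.

Lemma smooth_at_op (op : R -> R -> R) p f g :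
  (forall (W : set 'rV[R]_n) k (F G : 'rV[R]_n -> R), open W ->
    Ck_on W k F -> Ck_on W k G -> Ck_on W k (fun u => op (F u) (G u))) ->
  smooth_at p f -> smooth_at p g -> smooth_at p (fun q => op (f q) (g q)).
Proof.
move=> Hop [U [oU Up CU]] [U' [oU' Up' CU']].
have UA : nbhs p [set q | U q /\ U' q].
  by apply: filterS2 (open_nbhs_nbhs (conj oU Up)) (open_nbhs_nbhs (conj oU' Up')).
apply: (smooth_at_nbhs UA) => c ac k.
apply: (Hop _ k (f \o chart_point c) (g \o chart_point c)).
- exact: open_point_preimage (open_interior _).
- by apply: Ck_sub (CU c ac k) => u [cu /interior_subset[]].
- by apply: Ck_sub (CU' c ac k) => u [cu /interior_subset[]].
Qed.

Lemma smooth_atD p f g :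
  smooth_at p f -> smooth_at p g -> smooth_at p (fun q => f q + g q).
Proof. by apply: smooth_at_op => W k F G; exact: CkD. Qed.

Lemma smooth_atM p f g :
  smooth_at p f -> smooth_at p g -> smooth_at p (fun q => f q * g q).
Proof. by apply: smooth_at_op => W k F G; exact: CkM. Qed.

Lemma smooth_at_lin p (a : R) f g :
  smooth_at p f -> smooth_at p g -> smooth_at p (fun q => a * f q + g q).
Proof. by move=> sf; apply/smooth_atD/smooth_atM => //; exact: smooth_at_cst. Qed.

Lemma smooth_atB p f g :
  smooth_at p f -> smooth_at p g -> smooth_at p (fun q => f q - g q).
Proof.
move=> sf sg; have := smooth_at_lin (-1) sg sf.
by apply: smooth_at_ext; near=> q; rewrite mulN1r addrC.
Unshelve. all: by end_near. Qed.

Lemma smooth_at_sum p m (f : 'I_m -> M -> R) :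
  (forall i, smooth_at p (f i)) -> smooth_at p (fun q => \sum_i f i q).
Proof.
elim: m f => [|m IH] f sf.
  by rewrite (_ : (fun _ => _) = fun=> 0); [exact: smooth_at_cst|apply/funext => q; rewrite big_ord0].
rewrite (_ : (fun _ => _) = fun q => f ord0 q + \sum_i f (lift ord0 i) q).
  by apply: smooth_atD => //; apply: IH.
by apply/funext => q; rewrite big_ord_recl.
Qed.

Lemma smooth_at_chart p f c : atlas c -> chart_dom c p -> smooth_at p f ->
  Cinf_at (chart_coord c p) (f \o chart_point c).
Proof.
move=> ac cp [U [oU Up CU]].
exists [set u | chart_img c u /\ U (chart_point c u)]; split; last exact: CU.
- exact: open_point_preimage.
- by have [ci cpE] := coordP cp; split=> //; rewrite cpE.
Qed.

Lemma smooth_at_continuous p f : smooth_at p f -> {for p, continuous f}.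
Proof.
move=> sf; have [c ac cp] := atlas_cover p.
have [W [oW Wp CW]] := smooth_at_chart ac cp sf.
have : {for p, continuous ((f \o chart_point c) \o chart_coord c)}.
  by apply: continuous_comp; [exact: coord_cont|exact: Ck_continuous (CW 0) Wp].
move=> cf; apply: cvg_trans (_ : ((f \o chart_point c) \o chart_coord c) q @[q --> p] --> f p).
  by apply: near_eq_cvg; apply: filterS (near_dom cp) => q /coordP[_ /= ->].
by move: cf; rewrite /prop_for /continuous_at/= (coordP cp).2.
Qed.

Lemma smooth_at_coord c p i : atlas c -> chart_dom c p ->
  smooth_at p (fun q => chart_coord c q 0 i).
Proof.
move=> ac cp; exists (chart_dom c); split=> //; first exact: open_dom.
by move=> c' ac'; exact: (atlas_smooth ac' ac i).
Qed.

(** Smooth coordinates make [h] continuous, so near [p] it stays where [F] is smooth and [Ck_comp]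
    applies in every chart. *)
Lemma smooth_at_comp p m (h : M -> 'rV[R]_m) (F : 'rV[R]_m -> R) :
  (forall i, smooth_at p (fun q => h q 0 i)) -> Cinf_at (h p) F ->
  smooth_at p (F \o h).
Proof.
move=> sh [W [oW Wp CW]].
have ch : h q @[q --> p] --> h p.
  apply/cvgrPdist_le => /= e e0.
  have : \forall q \near p, forall i, `|h p 0 i - h q 0 i| <= e.
    by apply: filter_forall => i; have /smooth_at_continuous/cvgrPdist_le := sh i; exact.
  apply: filterS => q H; rewrite [leLHS]/Num.Def.normr/= mx_normrE.
  by apply: bigmax_le => [|[i j] _]; [exact: ltW|rewrite !mxE (ord1 i)/=].
have /fin_all_exists[U HU] := sh.
have UA : nbhs p [set q | (forall i, U i q) /\ W (h q)].
  have nW : nbhs p (h @^-1` W) by apply: ch; exact: open_nbhs_nbhs.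
  have nU : nbhs p (fun q => forall i, U i q).
    by apply: filter_forall => i; have [oU Up _] := HU i; exact: open_nbhs_nbhs.
  exact: filterS2 nU nW.
apply: (smooth_at_nbhs UA) => c ac k; rewrite -compA.
apply: Ck_comp oW _ (CW k) _.
- exact: open_point_preimage (open_interior _).
- by move=> u [_ /interior_subset[]].
- move=> i; have [_ _ /(_ c ac k)] := HU i; apply: Ck_sub.
  by move=> u [cu /interior_subset[]].
Qed.

End SmoothFunctions.

(** * Algebra and locality of derivations *)

Section Tangent.
Context {R : realType} {n : nat} {M : manifold R n}.
Implicit Types (p q : M) (f g : M -> R) (c : chart R M n).

Lemma tangent_out p (xi : tangent M p) f : ~ smooth_at p f -> xi f = 0.
Proof. by have /asboolP[H _ _] := tangentP xi; exact: H. Qed.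

Lemma tangent_lin p (xi : tangent M p) (a : R) f g : smooth_at p f -> smooth_at p g ->
  xi (fun q => a * f q + g q) = a * xi f + xi g.
Proof. by have /asboolP[_ H _] := tangentP xi; exact: H. Qed.

Lemma tangentM p (xi : tangent M p) f g : smooth_at p f -> smooth_at p g ->
  xi (fun q => f q * g q) = f p * xi g + g p * xi f.
Proof. by have /asboolP[_ _ H] := tangentP xi; exact: H. Qed.

Lemma tangentD p (xi : tangent M p) f g : smooth_at p f -> smooth_at p g ->
  xi (fun q => f q + g q) = xi f + xi g.
Proof.
move=> sf sg; rewrite -[xi f]mul1r -tangent_lin//; congr (xi _).
by apply/funext => q; rewrite mul1r.
Qed.

(** The Leibniz rule for [1 * 1] gives [xi 1 = xi 1 + xi 1], and the constant [a] is
    [(a - 1) * 1 + 1]. *)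
Lemma tangent_cst p (xi : tangent M p) (a : R) : xi (fun=> a) = 0.
Proof.
have s1 := smooth_at_cst p (1 : R).
have x1 : xi (fun=> 1) = 0.
  have := tangentM xi s1 s1; rewrite (_ : (fun _ => 1 * 1) = fun=> 1).
    by rewrite !mul1r => /eqP; rewrite -subr_eq0 opprD addrA subrr add0r oppr_eq0 => /eqP.
  by apply/funext => q; rewrite mulr1.
have := tangentM xi (smooth_at_cst p a) s1.
rewrite x1 mulr0 add0r mul1r.
have := tangent_lin xi (a - 1) s1 s1; rewrite x1 mulr0 addr0 => + _.
by rewrite (_ : (fun _ => _) = fun=> a)//; apply/funext => q; rewrite mulr1 subrK.
Qed.

Lemma tangentZ p (xi : tangent M p) (a : R) f : smooth_at p f ->
  xi (fun q => a * f q) = a * xi f.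
Proof.
move=> sf; rewrite (tangentM xi (smooth_at_cst p a) sf).
by rewrite tangent_cst mulr0 addr0.
Qed.

Lemma tangent_sum p (xi : tangent M p) m (f : 'I_m -> M -> R) :
  (forall i, smooth_at p (f i)) ->
  xi (fun q => \sum_i f i q) = \sum_i xi (f i).
Proof.
elim: m f => [|m IH] f sf.
  rewrite (_ : (fun _ => _) = fun=> 0); last by apply/funext => q; rewrite big_ord0.
  by rewrite tangent_cst big_ord0.
rewrite (_ : (fun _ => _) = fun q => f ord0 q + \sum_i f (lift ord0 i) q); last first.
  by apply/funext => q; rewrite big_ord_recl.
rewrite tangentD//; last exact: smooth_at_sum.
by rewrite IH// big_ord_recl.
Qed.

(* A function [h] vanishing near [p] is [h * chi] with [chi] the indicator of
   its support, which also vanishes near [p]. *)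
Lemma tangent_local p (xi : tangent M p) f g : (\forall q \near p, f q = g q) ->
  xi f = xi g.
Proof.
move=> fg; have [sf|nsf] := pselect (smooth_at p f); last first.
  rewrite !tangent_out// => sg; apply: nsf; apply: smooth_at_ext sg.
  by apply: filterS fg => q ->.
have sg : smooth_at p g by exact: smooth_at_ext sf.
pose h q := -1 * g q + f q; pose chi q : R := if h q == 0 then 0 else 1.
have h0 : \forall q \near p, h q = 0.
  by apply: filterS fg => q fgq; rewrite /h fgq mulN1r addNr.
have s0 := smooth_at_cst p (0 : R).
have sh : smooth_at p h by apply: smooth_at_ext s0; apply: filterS h0 => q ->.
have schi : smooth_at p chi.
  by apply: smooth_at_ext s0; apply: filterS h0 => q hq; rewrite /chi hq eqxx.
have := tangentM xi sh schi.
rewrite (_ : (fun q => h q * chi q) = h); last first.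
  by apply/funext => q; rewrite /chi; case: eqP => [->|]; rewrite ?mulr0 ?mulr1.
have hp : h p = 0 by exact: nbhs_singleton h0.
rewrite /chi hp eqxx !mul0r addr0 /h tangent_lin// mulN1r addrC => /eqP.
by rewrite subr_eq0 => /eqP.
Qed.

Lemma tangent_ext p (xi eta : tangent M p) :
  (forall f, smooth_at p f -> xi f = eta f) -> xi = eta.
Proof.
move=> H; apply: val_inj; apply/funext => f /=.
have [/H//|nsf] := pselect (smooth_at p f).
by rewrite !tangent_out.
Qed.

Lemma tangent_addE p (xi eta : tangent M p) f : (xi + eta) f = xi f + eta f.
Proof. by []. Qed.

Lemma tangent_scaleE p (a : R) (xi : tangent M p) f : (a *: xi) f = a * xi f.
Proof. by []. Qed.

Lemma tangent_oppE p (xi : tangent M p) f : (- xi) f = - xi f.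
Proof. by rewrite -scaleN1r tangent_scaleE mulN1r. Qed.

Lemma tangent_sumE p m (xi : 'I_m -> tangent M p) f :
  (\sum_i xi i) f = \sum_i xi i f.
Proof.
elim: m xi => [|m IH] xi; first by rewrite !big_ord0.
by rewrite !big_ord_recl tangent_addE IH.
Qed.

(** The two hypotheses are what prevents [mkT] from falling back to its default 0. *)
Lemma mkTE p (D : (M -> R) -> R) f :
  (forall (a : R) f g, smooth_at p f -> smooth_at p g ->
     D (fun q => a * f q + g q) = a * D f + D g) ->
  (forall f g, smooth_at p f -> smooth_at p g ->
     D (fun q => f q * g q) = f p * D g + g p * D f) ->
  smooth_at p f -> mkT p D f = D f.
Proof.
move=> DD DM sf; rewrite /mkT.
have H : (fun f => if `[< smooth_at p f >] then D f else 0) \in is_derivation p.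
  apply/asboolP; split=> [g nsg|a g h sg sh|g h sg sh].
    by rewrite (asboolF nsg).
  - have sgh := smooth_at_lin a sg sh.
    by rewrite (asboolT sg) (asboolT sh) (asboolT sgh) DD.
  - have sgh := smooth_atM sg sh.
    by rewrite (asboolT sg) (asboolT sh) (asboolT sgh) DM.
have := @insubdK _ _ (tangent M p) 0 _ H; move/(congr1 (fun F => F f)) => /= ->.
by rewrite (asboolT sf).
Qed.

End Tangent.

Section TangentCoordinates.
Context {R : realType} {n : nat} {M : manifold R n}.
Implicit Types (p q : M) (f g : M -> R) (c : chart R M n).

Definition tcoord c p (xi : tangent M p) : 'rV[R]_n :=
  \row_i xi (fun q => chart_coord c q 0 i).

Lemma tcoord_linear c p : linear (tcoord c (p := p)).
Proof. by move=> a xi eta; apply/rowP => i; rewrite !mxE. Qed.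

HB.instance Definition _ c p := GRing.isLinear.Build R _ _ _ (tcoord c (p := p)) (@tcoord_linear c p).

(** Hadamard's lemma writes [f] near [p] as a constant plus products of coordinate increments, which
    vanish at [p], with smooth functions. The Leibniz rule keeps only the values of the latter at
    [p], which are the partial derivatives. *)
Lemma tangent_coordE c p (xi : tangent M p) f :
  atlas c -> chart_dom c p -> smooth_at p f ->
  xi f = 'D_(tcoord c xi) (f \o chart_point c) (chart_coord c p).
Proof.
move=> ac cp sf; have [W [oW Wp CW]] := smooth_at_chart ac cp sf.
set u := chart_coord c p in Wp *; set F := f \o chart_point c in CW *.
have /nbhs_ballP[r /= r0 BW] := open_nbhs_nbhs (conj oW Wp).
have CB : Cinf_on (ball u r) F by move=> k; exact: Ck_sub (CW k).
have [G [CG Gu FG]] := hadamard r0 CB.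
have oB : open (ball u r) by exact: ball_open.
have Bu : ball u r u by exact: ballxx.
have scoord i := smooth_at_coord i ac cp.
have sG i : smooth_at p (G i \o chart_coord c).
  by apply: smooth_at_comp => //; exists (ball u r).
have su i : smooth_at p (fun q => chart_coord c q 0 i - u 0 i).
  by apply: smooth_atB => //; exact: smooth_at_cst.
have -> : xi f = xi (fun q => F u + \sum_i (chart_coord c q 0 i - u 0 i) * (G i \o chart_coord c) q).
  apply: tangent_local.
  have nB : \forall q \near p, ball u r (chart_coord c q).
    exact: (coord_cont cp (nbhsx_ballx _ _ r0)).
  apply: filterS2 (near_dom cp) nB => q cq Bq /=; rewrite -FG//.
  by rewrite /F /= (coordP cq).2.
rewrite tangentD ?tangent_cst ?add0r ?tangent_sum//; last 3 first.
- by move=> i; exact: smooth_atM.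
- exact: smooth_at_cst.
- by apply: smooth_at_sum => i; exact: smooth_atM.
have [_ ->] := is_derive_rVE (tcoord c xi) oB Bu (CB 1).
apply: eq_bigr => i _; rewrite tangentM//= subrr mul0r add0r mulrC.
congr (_ * _).
  rewrite /tcoord mxE (_ : (fun q => _) = fun q => -1 * (u 0 i) + 1 * chart_coord c q 0 i); last first.
    by apply/funext => q; rewrite mulN1r mul1r addrC.
  rewrite tangentD ?tangent_cst ?add0r ?tangentZ ?mul1r//; first exact: smooth_at_cst.
  by apply: smooth_atM => //; exact: smooth_at_cst.
by rewrite Gu.
Qed.

End TangentCoordinates.

(** * Coordinate fields and smoothness of vector fields *)

Section CoordinateFields.
Context {R : realType} {n : nat} {M : manifold R n}.
Implicit Types (p q : M) (f g : M -> R) (c : chart R M n) (X Y Z : vfield M).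

(** The field with constant components [v] in the chart [c], meaningful over [chart_dom c]. It
    serves to extend a single tangent vector to a smooth field. *)
Definition dcoord c (v : 'rV[R]_n) : vfield M := fun p =>
  mkT p (fun f => 'D_v (f \o chart_point c) (chart_coord c p)).

Lemma dcoordE c v p f : atlas c -> chart_dom c p -> smooth_at p f ->
  dcoord c v p f = 'D_v (f \o chart_point c) (chart_coord c p).
Proof.
move=> ac cp; have dv g : smooth_at p g -> derivable (g \o chart_point c) (chart_coord c p) v.
  by move=> /(smooth_at_chart ac cp)[W [_ Wp CW]]; exact: Ck_derivable (CW 1) Wp.
have cpE := (coordP cp).2.
apply: mkTE => [a g h sg sh|g h sg sh].
- rewrite (_ : _ \o _ = a \*: (g \o chart_point c) + (h \o chart_point c))//.
  by rewrite deriveD ?deriveZ//; [exact: dv|apply: derivableZ; exact: dv|exact: dv].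
- rewrite (_ : _ \o _ = (g \o chart_point c) * (h \o chart_point c))//.
  by rewrite deriveM /=; [rewrite cpE|exact: dv|exact: dv].
Qed.

Lemma tcoord_dcoord c v p : atlas c -> chart_dom c p -> tcoord c (dcoord c v p) = v.
Proof.
move=> ac cp; apply/rowP => i; rewrite mxE dcoordE//; last exact: smooth_at_coord.
have [_ <-] := is_derive_coord (chart_coord c p) v i.
apply: near_eq_derive.
apply: filterS (open_nbhs_nbhs (conj (@open_img _ _ _ c) (coordP cp).1)) => u cu /=.
by rewrite (pointP cu).2.
Qed.

Lemma tcoordK c p (xi : tangent M p) : atlas c -> chart_dom c p ->
  dcoord c (tcoord c xi) p = xi.
Proof.
move=> ac cp; apply: tangent_ext => f sf.
by rewrite dcoordE// (tangent_coordE _ ac cp sf).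
Qed.

(** This reduces most later equalities of tangent vectors to identities between row vectors. *)
Lemma tcoord_inj c p (xi eta : tangent M p) : atlas c -> chart_dom c p ->
  tcoord c xi = tcoord c eta -> xi = eta.
Proof. by move=> ac cp E; rewrite -(tcoordK xi ac cp) E tcoordK. Qed.

Lemma Cinf_derive u (F : 'rV[R]_n -> R) v : Cinf_at u F -> Cinf_at u ('D_v F).
Proof. by move=> [W [oW Wu CW]]; exists W; split=> // k; exact: Ck_derive (CW k.+1). Qed.

Lemma dcoord_smooth c v p : atlas c -> chart_dom c p -> vf_smooth_at p (dcoord c v).
Proof.
move=> ac cp f sf.
have : smooth_at p ('D_v (f \o chart_point c) \o chart_coord c).
  apply: smooth_at_comp => [i|]; first exact: smooth_at_coord.
  by apply: Cinf_derive; exact: smooth_at_chart.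
apply: smooth_at_ext; apply: filterS2 (near_dom cp) (near_smooth_at sf) => q cq sfq.
by rewrite /= dcoordE.
Qed.

Lemma vf_smooth_sum p m (f : 'I_m -> M -> R) (X : 'I_m -> vfield M) :
  (forall i, smooth_at p (f i)) -> (forall i, vf_smooth_at p (X i)) ->
  vf_smooth_at p (fun q => \sum_i f i q *: X i q).
Proof.
move=> sf sX g sg.
have : smooth_at p (fun q => \sum_i f i q * X i q g).
  by apply: smooth_at_sum => i; apply: smooth_atM => //; exact: sX.
by apply: smooth_at_ext; near=> q; rewrite tangent_sumE.
Unshelve. all: by end_near. Qed.

Lemma vf_smoothD p X Y : vf_smooth_at p X -> vf_smooth_at p Y ->
  vf_smooth_at p (fun q => X q + Y q).
Proof. by move=> sX sY f sf; apply: smooth_atD; [exact: sX|exact: sY]. Qed.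

Lemma vf_smoothZ p (a : R) X : vf_smooth_at p X -> vf_smooth_at p (fun q => a *: X q).
Proof. by move=> sX f sf; apply: smooth_atM; [exact: smooth_at_cst|exact: sX]. Qed.

Lemma vf_smoothB p X Y : vf_smooth_at p X -> vf_smooth_at p Y ->
  vf_smooth_at p (fun q => X q - Y q).
Proof.
move=> sX sY f sf; have := smooth_atB (sX f sf) (sY f sf).
by apply: smooth_at_ext; near=> q; rewrite tangent_addE tangent_oppE.
Unshelve. all: by end_near. Qed.

Lemma vf_smooth_ext p X Y : (\forall q \near p, X q = Y q) ->
  vf_smooth_at p X -> vf_smooth_at p Y.
Proof.
move=> XY sX f sf; apply: smooth_at_ext (sX f sf).
by apply: filterS XY => q ->.
Qed.

End CoordinateFields.

(** * Lie brackets and the Nijenhuis tensor *)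

Section Bracket.
Context {R : realType} {n : nat} {M : manifold R n}.
Implicit Types (p q : M) (f g : M -> R) (X Y Z : vfield M).

(** The bracket is built with [mkT], so it must be shown to be a derivation: the products of first
    derivatives in the Leibniz rule are symmetric in [X] and [Y] and cancel. *)
Lemma lieE p X Y f : vf_smooth_at p X -> vf_smooth_at p Y -> smooth_at p f ->
  lie X Y p f = X p (fun q => Y q f) - Y p (fun q => X q f).
Proof.
move=> sX sY sf.
have L Z Z' (a : R) g h : vf_smooth_at p Z' -> smooth_at p g -> smooth_at p h ->
    Z p (fun q => Z' q (fun q' => a * g q' + h q')) =
    a * Z p (fun q => Z' q g) + Z p (fun q => Z' q h).
  move=> sZ' sg sh; rewrite -tangent_lin; [|exact: sZ'..].
  apply: tangent_local.
  apply: filterS2 (near_smooth_at sg) (near_smooth_at sh) => q sgq shq.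
  by rewrite tangent_lin.
have P Z Z' g h : vf_smooth_at p Z' -> smooth_at p g -> smooth_at p h ->
    Z p (fun q => Z' q (fun q' => g q' * h q')) =
    (g p * Z p (fun q => Z' q h) + Z' p h * Z p g) +
    (h p * Z p (fun q => Z' q g) + Z' p g * Z p h).
  move=> sZ' sg sh; have sZg := sZ' g sg; have sZh := sZ' h sh.
  rewrite -!tangentM// -tangentD; [|exact: smooth_atM..].
  apply: tangent_local.
  apply: filterS2 (near_smooth_at sg) (near_smooth_at sh) => q sgq shq.
  by rewrite tangentM.
rewrite mkTE// => [a g h sg sh|g h sg sh]; first by rewrite !L//; ring.
by rewrite !P//; ring.
Qed.

Lemma lie_smooth p X Y : (\forall q \near p, vf_smooth_at q X) ->
  (\forall q \near p, vf_smooth_at q Y) -> vf_smooth_at p (lie X Y).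
Proof.
move=> sX sY f sf.
have sXp := nbhs_singleton sX; have sYp := nbhs_singleton sY.
have : smooth_at p (fun q => X q (fun q' => Y q' f) - Y q (fun q' => X q' f)).
  by apply: smooth_atB; [apply: sXp; exact: sYp|apply: sYp; exact: sXp].
apply: smooth_at_ext.
by apply: filterS3 (near_smooth_at sf) sX sY => q sfq sXq sYq; rewrite lieE.
Qed.

Lemma lie_local p X X' Y : (\forall q \near p, X q = X' q) ->
  lie X Y p = lie X' Y p.
Proof.
move=> XX; rewrite /lie; congr (mkT p _); apply/funext => f.
rewrite (nbhs_singleton XX); congr (_ - _); apply: tangent_local.
by apply: filterS XX => q ->.
Qed.

Lemma lie_anti p X Y : vf_smooth_at p X -> vf_smooth_at p Y ->
  lie X Y p = - lie Y X p.
Proof.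
move=> sX sY; apply: tangent_ext => f sf.
by rewrite tangent_oppE !lieE// opprB.
Qed.

Lemma lie_sum p m (f : 'I_m -> M -> R) (X : 'I_m -> vfield M) Y :
  (forall i, smooth_at p (f i)) -> (forall i, vf_smooth_at p (X i)) -> vf_smooth_at p Y ->
  lie (fun q => \sum_i f i q *: X i q) Y p =
    \sum_i (f i p *: lie (X i) Y p - Y p (f i) *: X i p).
Proof.
move=> sf sX sY; apply: tangent_ext => g sg.
rewrite lieE//; last exact: vf_smooth_sum.
rewrite !tangent_sumE.
rewrite (_ : (fun q => (\sum_i f i q *: X i q) g) = fun q => \sum_i f i q * X i q g); last first.
  by apply/funext => q; rewrite tangent_sumE.
rewrite tangent_sum; last by move=> i; apply: smooth_atM => //; exact: sX.
rewrite -sumrB; apply: eq_bigr => i _.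
rewrite tangent_addE tangent_oppE !tangent_scaleE lieE// tangentM//; last exact: sX.
by ring.
Qed.

Lemma lieD p X X' Y : vf_smooth_at p X -> vf_smooth_at p X' -> vf_smooth_at p Y ->
  lie (fun q => X q + X' q) Y p = lie X Y p + lie X' Y p.
Proof.
move=> sX sX' sY; apply: tangent_ext => g sg.
rewrite tangent_addE !lieE//; last exact: vf_smoothD.
by rewrite tangentD; [rewrite tangent_addE; ring|exact: sX|exact: sX'].
Qed.

Lemma lieZ p (a : R) X Y : vf_smooth_at p X -> vf_smooth_at p Y ->
  lie (fun q => a *: X q) Y p = a *: lie X Y p.
Proof.
move=> sX sY; apply: tangent_ext => g sg.
rewrite tangent_scaleE !lieE//; last exact: vf_smoothZ.
by rewrite tangentZ; [rewrite tangent_scaleE; ring|exact: sX].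
Qed.

End Bracket.

(** * Tensoriality and symmetries of the Nijenhuis tensor *)

Section Nijenhuis.
Context {R : realType} {n : nat} {M : manifold R n} (J : endo M).
Hypothesis acJ : almost_complex J.
Implicit Types (p q : M) (f g : M -> R) (X Y Z : vfield M).

Lemma smooth_app p X : vf_smooth_at p X -> vf_smooth_at p (app J X).
Proof. exact: acJ.2. Qed.

Lemma nijenhuis_local p X X' Y : (\forall q \near p, X q = X' q) ->
  nijenhuis J X Y p = nijenhuis J X' Y p.
Proof.
move=> XX; rewrite /nijenhuis.
have JXX : \forall q \near p, app J X q = app J X' q by apply: filterS XX => q; rewrite /app => ->.
by rewrite !(lie_local _ JXX) !(lie_local _ XX).
Qed.

Lemma nijenhuis_smooth p X Y : (\forall q \near p, vf_smooth_at q X) ->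
  (\forall q \near p, vf_smooth_at q Y) -> vf_smooth_at p (nijenhuis J X Y).
Proof.
move=> sX sY.
have sJX : \forall q \near p, vf_smooth_at q (app J X).
  by apply: filterS sX => q; exact: smooth_app.
have sJY : \forall q \near p, vf_smooth_at q (app J Y).
  by apply: filterS sY => q; exact: smooth_app.
apply: vf_smoothB; last exact: lie_smooth.
apply: vf_smoothB; last by apply: acJ.2; exact: lie_smooth.
apply: vf_smoothB; last by apply: acJ.2; exact: lie_smooth.
exact: lie_smooth.
Qed.

(** The derivatives of [f i] along [app J Y] cancel between two brackets, and those along [Y] cancel
    between the other two because [J] squares to -1. *)
Lemma nijenhuis_sum p m (f : 'I_m -> M -> R) (X : 'I_m -> vfield M) Y :
  (forall i, smooth_at p (f i)) -> (forall i, vf_smooth_at p (X i)) -> vf_smooth_at p Y ->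
  nijenhuis J (fun q => \sum_i f i q *: X i q) Y p =
    \sum_i f i p *: nijenhuis J (X i) Y p.
Proof.
move=> sf sX sY; have sJX i := smooth_app (sX i); have sJY := smooth_app sY.
rewrite /nijenhuis (_ : app J _ = fun q => \sum_i f i q *: app J (X i) q); last first.
  by apply/functional_extensionality_dep => q; rewrite /app linear_sum; apply: eq_bigr => i _; rewrite linearZ.
rewrite !lie_sum// !linear_sum -!big_split; apply: eq_bigr => i _ /=.
rewrite !linearB !linearZ /= [J p (app J (X i) p)]acJ.1 scalerN /app.
apply: tangent_ext => g _.
by rewrite !(tangent_addE, tangent_oppE, tangent_scaleE); ring.
Qed.

Lemma nijenhuis_anti p X Y : vf_smooth_at p X -> vf_smooth_at p Y ->
  nijenhuis J X Y p = - nijenhuis J Y X p.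
Proof.
move=> sX sY; rewrite /nijenhuis.
rewrite (lie_anti (smooth_app sX) (smooth_app sY)) (lie_anti (smooth_app sX) sY).
rewrite (lie_anti sX (smooth_app sY)) (lie_anti sX sY) !linearN /=.
apply: tangent_ext => g _.
by rewrite !(tangent_addE, tangent_oppE); ring.
Qed.

(** As [J] squares to -1, replacing [X] by [app J X] permutes the four brackets up to sign and
    [J]. *)
Lemma nijenhuis_app p X Y : vf_smooth_at p X -> vf_smooth_at p Y ->
  nijenhuis J (app J X) Y p = - J p (nijenhuis J X Y p).
Proof.
move=> sX sY; rewrite /nijenhuis.
have JJ : app J (app J X) = fun q => -1 *: X q.
  by apply/functional_extensionality_dep => q; rewrite /app acJ.1 scaleN1r.
rewrite JJ !lieZ//; last exact: smooth_app.
rewrite !linearB !linearZ /= !acJ.1; apply: tangent_ext => g _.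
by rewrite !(tangent_addE, tangent_oppE, tangent_scaleE); ring.
Qed.

End Nijenhuis.

(** * Bundle charts and linear connections *)

Section Push.
Context {R : realType} {n n' : nat} {M : manifold R n} {M' : manifold R n'}.

Lemma mkT_ext (p : M) (D D' : (M -> R) -> R) :
  (forall f, smooth_at p f -> D f = D' f) -> mkT p D = mkT p D'.
Proof.
move=> DD; rewrite /mkT; congr insubd; apply/funext => f.
by case: asboolP => // sf; exact: DD.
Qed.

Lemma pushE (F : M -> M') (p : M) (q : M') (xi : tangent M p) g :
  map_smooth_at p F -> F p = q -> smooth_at q g -> (push F xi : tangent M' q) g = xi (g \o F).
Proof.
move=> sF Fp; rewrite -Fp => sg; apply: mkTE => // [a f h sf sh|f h sf sh].
  by rewrite -(tangent_lin xi a (sF _ sf) (sF _ sh)).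
by rewrite -(tangentM xi (sF _ sf) (sF _ sh)).
Qed.

End Push.

Section BundleCharts.
Context {R : realType} {n k : nat} {L : manifold R n} {E : vbundle k L}.

Definition bundle_chart (c : chart R L n) (C : chart R E (n + k)) :=
  [/\ atlas c, atlas C, chart_dom C = bproj (v0 := E) @^-1` chart_dom c &
    forall y, chart_dom c y ->
      [/\ forall v : fib E y, lsubmx (chart_coord C (fibpt v)) = chart_coord c y,
          linear (fun v : fib E y => rsubmx (chart_coord C (fibpt v)) : 'rV[R]_k) &
          bijective (fun v : fib E y => rsubmx (chart_coord C (fibpt v)))]].

Lemma bundle_chart_exists (x : L) : exists c C, bundle_chart c C /\ chart_dom c x.
Proof.
by have [c [C [ac cx aC dC H]]] := local_triviality E x; exists c, C.
Qed.

Section InChart.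
Variables (c : chart R L n) (C : chart R E (n + k)).
Hypothesis bc : bundle_chart c C.
Implicit Types (x y : L) (a : E) (s : @bsection _ _ _ _ E).

Let ac : atlas c. Proof. by case: bc. Qed.
Let aC : atlas C. Proof. by case: bc. Qed.

Definition fcoord {y} (v : fib E y) : 'rV[R]_k := rsubmx (chart_coord C (fibpt v)).

Lemma dom_total a : chart_dom C a = chart_dom c (bproj a).
Proof. by have [_ _ -> _] := bc. Qed.

Lemma dom_fibpt y (v : fib E y) : chart_dom c y -> chart_dom C (fibpt v).
Proof. by move=> cy; rewrite dom_total bproj_fibpt. Qed.

Lemma coord_fibpt y (v : fib E y) : chart_dom c y ->
  chart_coord C (fibpt v) = row_mx (chart_coord c y) (fcoord v).
Proof.
move=> cy; have [_ _ _ /(_ y cy)[l _ _]] := bc.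
by rewrite -(l v) /fcoord hsubmxK.
Qed.

Lemma fcoord_lin y (b : R) (v w : fib E y) : chart_dom c y ->
  fcoord (b *: v + w) = b *: fcoord v + fcoord w.
Proof. by move=> cy; have [_ _ _ /(_ y cy)[_ l _]] := bc; exact: l. Qed.

Lemma fcoord0 y : chart_dom c y -> fcoord (0 : fib E y) = 0.
Proof.
move=> cy; have := fcoord_lin (-1) (0 : fib E y) 0 cy.
by rewrite scaler0 addr0 scaleN1r addNr.
Qed.

Lemma fcoordD y (v w : fib E y) : chart_dom c y -> fcoord (v + w) = fcoord v + fcoord w.
Proof. by move=> cy; have := fcoord_lin 1 v w cy; rewrite !scale1r. Qed.

Lemma fcoordZ y (b : R) (v : fib E y) : chart_dom c y -> fcoord (b *: v) = b *: fcoord v.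
Proof. by move=> cy; have := fcoord_lin b v 0 cy; rewrite !addr0 fcoord0// addr0. Qed.

Lemma fcoordB y (v w : fib E y) : chart_dom c y -> fcoord (v - w) = fcoord v - fcoord w.
Proof. by move=> cy; rewrite fcoordD// -scaleN1r fcoordZ// scaleN1r. Qed.

Lemma fcoord_sum y m (v : 'I_m -> fib E y) : chart_dom c y ->
  fcoord (\sum_i v i) = \sum_i fcoord (v i).
Proof.
move=> cy; elim: m v => [|m IH] v; first by rewrite !big_ord0 fcoord0.
by rewrite !big_ord_recl fcoordD// IH.
Qed.

Lemma fcoord_inj y (v w : fib E y) : chart_dom c y -> fcoord v = fcoord w -> v = w.
Proof. by move=> cy; have [_ _ _ /(_ y cy)[_ _ /bij_inj]] := bc; apply. Qed.

(** The inverse of [fcoord] on fibres over [chart_dom c]; the default 0 occurs only when no vector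
    has the coordinates [u]. *)
Definition fpoint y (u : 'rV[R]_k) : fib E y := xget 0 [set v | fcoord v = u].

Lemma fpointK y u : chart_dom c y -> fcoord (fpoint y u) = u.
Proof.
move=> cy; have [_ _ _ /(_ y cy)[_ _ [g _ gK]]] := bc.
by rewrite /fpoint; apply: (@xgetPex _ 0 [set v | fcoord v = u]); exists (g u); exact: gK.
Qed.

Lemma fcoordK y (v : fib E y) : chart_dom c y -> fpoint y (fcoord v) = v.
Proof. by move=> cy; apply: fcoord_inj => //; rewrite fpointK. Qed.

Lemma smooth_fcoord y (v : fib E y) m : chart_dom c y ->
  smooth_at (fibpt v) (fun a => rsubmx (chart_coord C a) 0 m).
Proof.
move=> cy; have := smooth_at_coord (rshift n m) aC (dom_fibpt v cy).
by apply: smooth_at_ext; near=> a; rewrite mxE.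
Unshelve. all: by end_near. Qed.

(** In a bundle chart [bproj] is the projection to the first [n] coordinates. *)
Lemma smooth_bproj a : chart_dom C a -> map_smooth_at a (@bproj _ _ _ _ E).
Proof.
move=> Ca g sg; have ca : chart_dom c (bproj a) by rewrite -dom_total.
have E1 b : chart_dom C b -> chart_coord c (bproj b) = lsubmx (chart_coord C b).
  move=> Cb; rewrite -[in RHS](fibpt_fibvec b) coord_fibpt ?row_mxKl//.
  by rewrite -dom_total.
have : smooth_at a ((g \o chart_point c) \o (fun b => lsubmx (chart_coord C b) : 'rV_n)).
  apply: smooth_at_comp => [i|]; last by rewrite -E1//; exact: smooth_at_chart.
  have := smooth_at_coord (lshift k i) aC Ca.
  by apply: smooth_at_ext; near=> b; rewrite mxE.
apply: smooth_at_ext; apply: filterS (near_dom Ca) => b Cb /=.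
by rewrite -E1// (coordP _).2// -dom_total.
Unshelve. all: by end_near. Qed.

(** The base coordinates of [fibpt (s y)] are those of [y], hence smooth in any case. *)
Lemma sec_smoothP x s : chart_dom c x ->
  sec_smooth_at x s <-> forall m, smooth_at x (fun y => fcoord (s y) 0 m).
Proof.
move=> cx; split=> [ss m|ss g sg]; first exact: (ss _ (smooth_fcoord (s x) m cx)).
have : smooth_at x ((g \o chart_point C) \o (fun y => chart_coord C (fibpt (s y)))).
  apply: smooth_at_comp => [i|]; last by apply: smooth_at_chart => //; exact: dom_fibpt.
  case: (split_ordP i) => j ->.
    apply: smooth_at_ext (smooth_at_coord j ac cx).
    by apply: filterS (near_dom cx) => y cy; rewrite coord_fibpt// row_mxEl.
  by apply: smooth_at_ext (ss j); near=> y; rewrite /fcoord mxE.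
apply: smooth_at_ext; apply: filterS (near_dom cx) => y cy /=.
by rewrite (coordP (dom_fibpt (s y) cy)).2.
Unshelve. all: by end_near. Qed.

Lemma sec_smooth0 x : chart_dom c x -> sec_smooth_at x (fun y => 0 : fib E y).
Proof.
move=> cx; apply/sec_smoothP => // m; have := smooth_at_cst x (0 : R).
apply: smooth_at_ext; apply: filterS (near_dom cx) => y cy.
by rewrite (fcoord0 cy) mxE.
Qed.

Lemma sec_smooth_const x u : chart_dom c x -> sec_smooth_at x (fun y => fpoint y u).
Proof.
move=> cx; apply/sec_smoothP => // m; have := smooth_at_cst x (u 0 m).
apply: smooth_at_ext; apply: filterS (near_dom cx) => y cy.
by rewrite fpointK.
Qed.

Lemma sec_smoothZ x f s : chart_dom c x -> smooth_at x f -> sec_smooth_at x s ->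
  sec_smooth_at x (fun y => f y *: s y).
Proof.
move=> cx sf /(sec_smoothP _ cx) ss; apply/sec_smoothP => // m.
have := smooth_atM sf (ss m).
apply: smooth_at_ext; apply: filterS (near_dom cx) => y cy.
by rewrite fcoordZ // !mxE.
Qed.

Lemma sec_smoothD x s t : chart_dom c x -> sec_smooth_at x s -> sec_smooth_at x t ->
  sec_smooth_at x (fun y => s y + t y).
Proof.
move=> cx /(sec_smoothP _ cx) ss /(sec_smoothP _ cx) st; apply/sec_smoothP => // m.
have := smooth_atD (ss m) (st m).
apply: smooth_at_ext; apply: filterS (near_dom cx) => y cy.
by rewrite fcoordD // !mxE.
Qed.

Lemma sec_smooth_sum x m (t : 'I_m -> @bsection _ _ _ _ E) : chart_dom c x ->
  (forall i, sec_smooth_at x (t i)) -> sec_smooth_at x (fun y => \sum_i t i y).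
Proof.
move=> cx; elim: m t => [|m IH] t st.
  rewrite (_ : (fun _ => _) = fun y => 0 : fib E y); first exact: sec_smooth0.
  by apply/functional_extensionality_dep => y; rewrite big_ord0.
rewrite (_ : (fun _ => _) = fun y => t ord0 y + \sum_i t (lift ord0 i) y).
  by apply: sec_smoothD => //; exact: IH.
by apply/functional_extensionality_dep => y; rewrite big_ord_recl.
Qed.

(** A line in the fibre is a straight line in the bundle chart, so the two difference quotients
    agree before any limit is taken. *)
Lemma derive1_fibre y (v w : fib E y) (f : E -> R) : chart_dom c y ->
  derive1 (fun t : R => f (fibpt (v + t *: w))) 0 =
  'D_(row_mx 0 (fcoord w)) (f \o chart_point C) (chart_coord C (fibpt v)).
Proof.
move=> cy; have Cv := dom_fibpt v cy; rewrite /derive1 /derive.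
set A := fun h => _; set B := fun h => _; suff -> : A = B by [].
apply/funext => h; rewrite /A /B /= addr0 scale0r addr0 (coordP Cv).2.
rewrite -(coordP (dom_fibpt (v + h *: w) cy)).2; congr (_ *: (f (chart_point C _) - _)).
by rewrite !coord_fibpt// fcoordD// fcoordZ// scale_row_mx add_row_mx scaler0 add0r addrC.
Qed.

Lemma tcoord_vert y (v w : fib E y) a : chart_dom c y -> a = fibpt v ->
  tcoord C (vert v w : tangent E a) = row_mx 0 (fcoord w).
Proof.
move=> cy ->; rewrite -[RHS](tcoord_dcoord _ aC (dom_fibpt v cy)); congr tcoord.
by apply: mkT_ext => f _; exact: derive1_fibre.
Qed.

Lemma vertE y (v w : fib E y) a g : chart_dom c y -> a = fibpt v -> smooth_at a g ->
  (vert v w : tangent E a) g = derive1 (fun t : R => g (fibpt (v + t *: w))) 0.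
Proof.
move=> cy av sg; have Ca : chart_dom C a by rewrite av; exact: dom_fibpt.
by rewrite (tangent_coordE _ aC Ca sg) tcoord_vert// av derive1_fibre.
Qed.

Lemma vert_lin y (v w w' : fib E y) (b : R) : chart_dom c y ->
  (vert v (b *: w + w') : tangent E (fibpt v)) = b *: vert v w + vert v w'.
Proof.
move=> cy; apply: (tcoord_inj aC (dom_fibpt v cy)).
by rewrite linearP /= !tcoord_vert// fcoord_lin// scale_row_mx add_row_mx scaler0 addr0.
Qed.

Lemma tcoord_vert_lift s a : chart_dom C a ->
  tcoord C (vert_lift s a) = row_mx 0 (fcoord (s (bproj a))).
Proof. by rewrite dom_total => ca; apply: tcoord_vert => //; rewrite fibpt_fibvec. Qed.

Lemma tcoord_radial a : chart_dom C a ->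
  tcoord C (radial a) = row_mx 0 (rsubmx (chart_coord C a)).
Proof.
rewrite dom_total => ca; rewrite tcoord_vert//; last by rewrite fibpt_fibvec.
by rewrite /fcoord fibpt_fibvec.
Qed.

Lemma tcoord_push_sec x s (xi : tangent L x) : chart_dom c x -> sec_smooth_at x s ->
  tcoord C (push (fun y => fibpt (s y)) xi : tangent E (fibpt (s x))) =
  row_mx (tcoord c xi) (\row_m xi (fun y => fcoord (s y) 0 m)).
Proof.
move=> cx ss; apply/rowP => i; rewrite mxE pushE//; last first.
  by apply: smooth_at_coord => //; exact: dom_fibpt.
case: (split_ordP i) => j ->; rewrite (row_mxEl, row_mxEr) !mxE.
  apply: tangent_local; apply: filterS (near_dom cx) => y cy /=.
  by rewrite coord_fibpt// row_mxEl.
by congr (xi _); apply/funext => y; rewrite /fcoord mxE.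
Qed.

Lemma tcoord_push_zsec x (xi : tangent L x) : chart_dom c x ->
  tcoord C (push (zsec (E := E)) xi : tangent E (zsec x)) = row_mx (tcoord c xi) 0.
Proof.
move=> cx; have := tcoord_push_sec xi cx (sec_smooth0 cx).
rewrite /zsec => ->; congr row_mx; apply/rowP => m; rewrite !mxE -(tangent_cst xi 0).
apply: tangent_local; apply: filterS (near_dom cx) => y cy.
by rewrite (fcoord0 cy) mxE.
Qed.

Lemma tcoord_push_bproj a x (xi : tangent E a) : chart_dom C a -> bproj a = x ->
  tcoord c (push (@bproj _ _ _ _ E) xi : tangent L x) = lsubmx (tcoord C xi).
Proof.
move=> Ca ax; have ca : chart_dom c x by rewrite -ax -dom_total.
apply/rowP => i; rewrite !mxE pushE//; last 2 first.
- exact: smooth_bproj.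
- exact: smooth_at_coord.
apply: tangent_local; apply: filterS (near_dom Ca) => b Cb /=.
rewrite -[in RHS](fibpt_fibvec b) coord_fibpt ?row_mxEl//.
by rewrite -dom_total.
Qed.

Lemma fcoord_normal_class x (eta : tangent E (zsec x)) : chart_dom c x ->
  fcoord (normal_class eta) = rsubmx (tcoord C eta).
Proof.
move=> cx; have Cx : chart_dom C (zsec x) by exact: dom_fibpt.
pose A := [set w : fib E x | exists xi : tangent L x, eta = push (@zsec _ _ _ _ E) xi + vert 0 w].
have : A (normal_class eta).
  apply: (@xgetPex _ 0 A); exists (fpoint x (rsubmx (tcoord C eta))).
  exists (push (@bproj _ _ _ _ E) eta); apply: (tcoord_inj aC Cx).
  rewrite linearD /= tcoord_push_zsec// tcoord_push_bproj//; last exact: bproj_fibpt.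
  by rewrite tcoord_vert// fpointK// add_row_mx addr0 add0r hsubmxK.
(* A decomposition exists, so [xget] returns the vertical part of one; the fibre components of
   [push zsec xi] vanish and leave exactly that part. *)
move=> [xi {2}->]; rewrite linearD /= tcoord_push_zsec// tcoord_vert//.
by rewrite add_row_mx add0r row_mxKr.
Qed.

End InChart.
End BundleCharts.

(** * Linear connections in a bundle chart *)

Section Connections.
Context {R : realType} {n k : nat} {L : manifold R n} {E : vbundle k L}.
Variables (D : forall x, tangent L x -> @bsection _ _ _ _ E -> fib E x).
Hypothesis cD : linear_connection D.
Variables (c : chart R L n) (C : chart R E (n + k)).
Hypothesis bc : bundle_chart c C.
Implicit Types (x y : L) (s t : @bsection _ _ _ _ E).

Lemma connection0 x (xi : tangent L x) : chart_dom c x ->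
  D xi (fun y => 0 : fib E y) = 0.
Proof.
move=> cx; case: cD => _ _ DM _.
have := DM x xi (fun=> 0) _ (smooth_at_cst x 0) (sec_smooth0 bc cx).
rewrite (_ : (fun q => 0 *: 0) = fun y => 0 : fib E y).
  by rewrite scaler0 scale0r addr0.
by apply/functional_extensionality_dep => y; rewrite scale0r.
Qed.

Lemma connectionZ x (xi : tangent L x) (b : R) s : sec_smooth_at x s ->
  D xi (fun y => b *: s y) = b *: D xi s.
Proof.
move=> ss; case: cD => _ _ DM _.
by rewrite (DM x xi (fun=> b) _ (smooth_at_cst x b) ss) tangent_cst scale0r add0r.
Qed.

(** As in [tangent_local]: the difference of the sections is unchanged by the indicator of its
    support, which vanishes near [x], and the Leibniz rule applies to this product. *)
Lemma connection_local x (xi : tangent L x) s t : chart_dom c x ->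
  sec_smooth_at x s -> sec_smooth_at x t -> (\forall y \near x, s y = t y) ->
  D xi s = D xi t.
Proof.
move=> cx ss st st0; case: cD => _ DA DM _.
pose w y := s y - t y; pose chi y : R := if s y == t y then 0 else 1.
have s0 := smooth_at_cst x (0 : R).
have sw : sec_smooth_at x w.
  apply/(sec_smoothP bc _ cx) => m; apply: smooth_at_ext s0.
  apply: filterS2 (near_dom cx) st0 => y cy sty.
  by rewrite /w sty subrr (fcoord0 bc cy) mxE.
have schi : smooth_at x chi.
  by apply: smooth_at_ext s0; apply: filterS st0 => y sty; rewrite /chi sty eqxx.
have := DM x xi chi w schi sw.
rewrite (_ : (fun q => chi q *: w q) = w); last first.
  apply/functional_extensionality_dep => y; rewrite /chi /w.
  by case: eqP => [->|]; rewrite ?subrr ?scaler0 ?scale1r.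
have sx := nbhs_singleton st0.
rewrite /chi sx eqxx scale0r addr0 {2}/w sx subrr scaler0 => Dw.
have := DA x xi t w st sw; rewrite Dw addr0 => <-; congr D.
by apply/functional_extensionality_dep => y; rewrite /w addrC subrK.
Qed.

Lemma connection_sum x (xi : tangent L x) m (t : 'I_m -> @bsection _ _ _ _ E) :
  chart_dom c x -> (forall i, sec_smooth_at x (t i)) ->
  D xi (fun y => \sum_i t i y) = \sum_i D xi (t i).
Proof.
move=> cx; elim: m t => [|m IH] t st.
  rewrite big_ord0 -(connection0 xi cx); congr D.
  by apply/functional_extensionality_dep => y; rewrite big_ord0.
rewrite big_ord_recl -IH//; case: cD => _ DA _ _.
rewrite -DA//; last exact: (sec_smooth_sum bc).
by congr D; apply/functional_extensionality_dep => y; rewrite big_ord_recl.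
Qed.

Lemma connection_frame x (xi : tangent L x) s : chart_dom c x -> sec_smooth_at x s ->
  D xi s = \sum_m (xi (fun y => fcoord C (s y) 0 m) *: fpoint C x (delta_mx 0 m)
                   + fcoord C (s x) 0 m *: D xi (fun y => fpoint C y (delta_mx 0 m))).
Proof.
move=> cx ss; have scs := (sec_smoothP bc s cx).1 ss.
have se m : sec_smooth_at x (fun y => fpoint C y (delta_mx 0 m)) by exact: (sec_smooth_const bc).
have ssum m : sec_smooth_at x (fun y => fcoord C (s y) 0 m *: fpoint C y (delta_mx 0 m)).
  exact: (sec_smoothZ bc).
have -> : D xi s = D xi (fun y => \sum_m fcoord C (s y) 0 m *: fpoint C y (delta_mx 0 m)).
  apply: connection_local => //; first exact: (sec_smooth_sum bc).
  apply: filterS (near_dom cx) => y cy; apply: (fcoord_inj bc cy).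
  rewrite (fcoord_sum bc)// [LHS]row_sum_delta; apply: eq_bigr => m _.
  by rewrite (fcoordZ bc)// (fpointK bc).
rewrite connection_sum//; apply: eq_bigr => m _.
by case: cD => _ _ DM _; rewrite DM.
Qed.

(** In [connection_frame] the terms without derivatives depend on [s x] only, and they are the
    derivative of the section with constant components through [s x]. *)
Lemma connection_const x (xi : tangent L x) s : chart_dom c x -> sec_smooth_at x s ->
  D xi s = D xi (fun y => fpoint C y (fcoord C (s x)))
         + fpoint C x (\row_m xi (fun y => fcoord C (s y) 0 m)).
Proof.
move=> cx ss.
have sc : sec_smooth_at x (fun y => fpoint C y (fcoord C (s x))) by exact: (sec_smooth_const bc).
rewrite (connection_frame xi cx ss) (connection_frame xi cx sc).
rewrite big_split /= addrC; congr (_ + _).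
  apply: eq_bigr => m _; rewrite (fpointK bc)//.
  rewrite (_ : xi _ = 0) ?scale0r ?add0r// -(tangent_cst xi (fcoord C (s x) 0 m)).
  by apply: tangent_local; apply: filterS (near_dom cx) => y cy; rewrite (fpointK bc).
apply: (fcoord_inj bc cx); rewrite (fpointK bc)// (fcoord_sum bc)//.
rewrite [RHS]row_sum_delta; apply: eq_bigr => m _.
by rewrite (fcoordZ bc)// (fpointK bc)// mxE.
Qed.

End Connections.

(** * The Nijenhuis tensor on radial and vertical fields *)

Section Frames.
Context {R : realType} {n k : nat} {L : manifold R n} {E : vbundle k L}.
Variables (c : chart R L n) (C : chart R E (n + k)).
Hypothesis bc : bundle_chart c C.
Let ac : atlas c. Proof. by case: bc. Qed.
Let aC : atlas C. Proof. by case: bc. Qed.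

Definition vframe (m : 'I_k) : vfield E := dcoord C (row_mx 0 (delta_mx 0 m)).

Lemma vertical_frameE (a : E) (eta : tangent E a) (u : 'rV[R]_k) : chart_dom C a ->
  tcoord C eta = row_mx 0 u -> eta = \sum_m u 0 m *: vframe m a.
Proof.
move=> Ca etaE; apply: (tcoord_inj aC Ca); rewrite etaE linear_sum /=.
under eq_bigr do rewrite linearZ /= (tcoord_dcoord _ aC Ca).
rewrite {1}[u]row_sum_delta; elim/big_ind2 : _ => [|u1 v1 u2 v2 <- <-|m _].
- by rewrite row_mx0.
- by rewrite add_row_mx addr0.
- by rewrite scale_row_mx scaler0.
Qed.

(** The radial field is the sum of the fibre coordinates times the vertical coordinate fields, and
    the tensor is linear over functions. *)
Lemma nijenhuis_radial (Jh : endo E) (a : E) X : almost_complex Jh ->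
  chart_dom C a -> vf_smooth_at a X ->
  nijenhuis Jh (radial (E := E)) X a =
  \sum_m rsubmx (chart_coord C a) 0 m *: nijenhuis Jh (vframe m) X a.
Proof.
move=> acJ Ca sX.
rewrite (@nijenhuis_local _ _ _ _ _ _
  (fun q => \sum_m rsubmx (chart_coord C q) 0 m *: vframe m q)); last first.
  apply: filterS (near_dom Ca) => q Cq; apply: vertical_frameE => //.
  exact: (tcoord_radial bc).
rewrite nijenhuis_sum// => m; last exact: dcoord_smooth.
have := smooth_at_coord (rshift n m) aC Ca.
by apply: smooth_at_ext; near=> b; rewrite mxE.
Unshelve. all: by end_near. Qed.

(** Both conclusions come from expanding the lift in the vertical frame, with coefficients that are
    constant along the fibres. *)
Lemma nijenhuis_vert_lift (Jh : endo E) (x : L) s X : almost_complex Jh ->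
  chart_dom c x -> sec_smooth_at x s -> vf_smooth_at (zsec x) X ->
  vf_smooth_at (zsec x) (vert_lift s) /\
  nijenhuis Jh (vert_lift s) X (zsec x) =
  \sum_m fcoord C (s x) 0 m *: nijenhuis Jh (vframe m) X (zsec x).
Proof.
move=> acJ cx ss sX; have Cx : chart_dom C (zsec x) by exact: (dom_fibpt bc).
have sm m : smooth_at (zsec x) (fun q : E => fcoord C (s (bproj q)) 0 m).
  have sg : smooth_at (bproj (zsec (E := E) x)) (fun y => fcoord C (s y) 0 m).
    by rewrite bproj_fibpt; exact: ((sec_smoothP bc s cx).1 ss).
  exact: (smooth_bproj bc Cx sg).
have sV m : vf_smooth_at (zsec x) (vframe m) by exact: dcoord_smooth.
have nS : \forall q \near zsec x,
    \sum_m fcoord C (s (bproj q)) 0 m *: vframe m q = vert_lift s q.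
  apply: filterS (near_dom Cx) => q Cq; apply/esym/vertical_frameE => //.
  exact: (tcoord_vert_lift bc).
split; first by apply: vf_smooth_ext nS _; exact: vf_smooth_sum.
by rewrite -(nijenhuis_local _ _ nS) nijenhuis_sum// bproj_fibpt.
Qed.

End Frames.

(** * The dbar operator of the normal connection *)

Section ZeroSection.
Context {R : realType} {n k : nat} {L : manifold R n} {E : vbundle k L}.
Variables (J : endo L) (Jh J0 T : endo E).
Hypothesis PHh : PH_bundle J Jh.
Hypothesis PH0 : PH_bundle J J0.
(* [T] is [Jh] or [J0], according to which of the two relations between them is
   given. *)
Hypothesis acT : almost_complex T.
Hypothesis J0E : forall a X, vf_smooth_at a X ->
  J0 a (X a) = Jh a (X a) - 2^-1 *: T a (nijenhuis Jh (radial (E := E)) X a).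

Let acJh : almost_complex Jh. Proof. by case: PHh. Qed.
Let acJ0 : almost_complex J0. Proof. by case: PH0. Qed.

Section InChart.
Variables (c : chart R L n) (C : chart R E (n + k)) (x : L).
Hypotheses (bc : bundle_chart c C) (cx : chart_dom c x).
Let ac : atlas c. Proof. by case: bc. Qed.
Let aC : atlas C. Proof. by case: bc. Qed.
Local Notation p := (zsec (E := E) x).
Let Cp : chart_dom C p. Proof. exact: (dom_fibpt bc). Qed.

(** A linear connection kills the zero section, so its horizontal lifts there are the tangent
    vectors of the zero section, and these lifts are complex linear. *)
Lemma Jh_zsec (xi : tangent L x) :
  Jh p (push (zsec (E := E)) xi) = push (zsec (E := E)) (J x xi).
Proof.
case: PHh => _ _ _ _ [D [cD /(_ x _ _ (sec_smooth0 bc cx))H]].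
have v0 : vert (0 : fib E x) 0 = 0 :> tangent E p.
  by apply: (tcoord_inj aC Cp); rewrite (tcoord_vert bc)// (fcoord0 bc)// row_mx0 linear0.
by have := H xi; rewrite /hlift !(connection0 cD bc)// v0 !subr0.
Qed.

(** The correction term is tensorial in the radial field, which vanishes on the zero section. *)
Lemma J0_zsec (eta : tangent E p) : J0 p eta = Jh p eta.
Proof.
(* The relation [J0E] speaks of fields, so [eta] is extended with constant components. *)
have sX := dcoord_smooth (tcoord C eta) aC Cp.
have := J0E sX; rewrite (tcoordK eta aC Cp) (nijenhuis_radial bc acJh Cp sX) => ->.
rewrite big1 ?linear0 ?scaler0 ?oppr0 ?addr0// => m _.
by rewrite -/(fcoord C _) (fcoord0 bc cx) mxE scale0r.
Qed.

Variables (j : {linear fib E x -> fib E x}).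
Hypothesis jE : forall v w : fib E x, J0 (fibpt v) (vert v w) = vert v (j w).

(** [Jh] preserves the tangent space of the zero section, so only the vertical part counts; on it
    [Jh] agrees with [J0], which is [j]. *)
Lemma normal_class_Jh (eta : tangent E p) :
  normal_class (Jh p eta) = j (normal_class eta).
Proof.
apply: (fcoord_inj bc cx); rewrite (fcoord_normal_class bc)//.
have etaE : eta = push (zsec (E := E)) (push (@bproj _ _ _ _ E) eta : tangent L x)
              + vert 0 (normal_class eta).
  apply: (tcoord_inj aC Cp); rewrite linearD /= (tcoord_push_zsec bc)//.
  rewrite (tcoord_push_bproj bc)//; last exact: bproj_fibpt.
  rewrite (tcoord_vert bc)// (fcoord_normal_class bc)//.
  by rewrite add_row_mx addr0 add0r hsubmxK.
rewrite {1}etaE; set w := normal_class eta.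
rewrite linearD /= Jh_zsec linearD /= (tcoord_push_zsec bc)//.
have -> : Jh p (vert 0 w) = vert 0 (j w) by rewrite -J0_zsec; exact: jE.
by rewrite (tcoord_vert bc)// add_row_mx row_mxKr add0r.
Qed.

Section Along.
Variable s : @bsection _ _ _ _ E.
Hypothesis ss : sec_smooth_at x s.
Local Notation S := (vert_lift s).

Lemma vert_lift_smooth : vf_smooth_at p S.
Proof.
(* The zero field is a placeholder: the smoothness half of the conclusion is wanted. *)
have sX := dcoord_smooth 0 aC Cp.
by have [] := nijenhuis_vert_lift bc acJh cx ss sX.
Qed.

(* The tensor [nijenhuis Jh] is linear over functions and the radial field is
   linear along the fibres and zero at [p], so only its derivative in the
   direction of [S] contributes. *)
Lemma lie_nijenhuis_radial (v : 'rV[R]_(n + k)) (X := dcoord C v) :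
    (forall eta, T p eta = Jh p eta) ->
  vf_smooth_at p (fun a => T a (nijenhuis Jh (radial (E := E)) X a)) /\
  lie (fun a => T a (nijenhuis Jh (radial (E := E)) X a)) S p =
    - Jh p (nijenhuis Jh S X p).
Proof.
move=> TE; pose B m : vfield E := fun a => T a (nijenhuis Jh (vframe C m) X a).
have sS := vert_lift_smooth.
have sy m : smooth_at p (fun q : E => rsubmx (chart_coord C q) 0 m).
  exact: (smooth_fcoord bc).
have nE : \forall q \near p, \sum_m rsubmx (chart_coord C q) 0 m *: B m q
    = T q (nijenhuis Jh (radial (E := E)) X q).
  apply: filterS (near_dom Cp) => q Cq.
  rewrite (nijenhuis_radial bc acJh Cq (dcoord_smooth v aC Cq)) linear_sum.
  by apply: eq_bigr => m _; rewrite linearZ.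
have sB m : vf_smooth_at p (B m).
  apply: acT.2; have nX : \forall q \near p, vf_smooth_at q X.
    by apply: filterS (near_dom Cp) => q Cq; exact: dcoord_smooth.
  have nV : \forall q \near p, vf_smooth_at q (vframe C m).
    by apply: filterS (near_dom Cp) => q Cq; exact: dcoord_smooth.
  exact: nijenhuis_smooth.
split; first by apply: vf_smooth_ext nE _; exact: vf_smooth_sum.
have sX := dcoord_smooth v aC Cp.
have [_ ->] := nijenhuis_vert_lift bc acJh cx ss sX.
rewrite -(lie_local _ nE) lie_sum// linear_sum -sumrN; apply: eq_bigr => m _.
rewrite -/(fcoord C _) (fcoord0 bc cx) mxE scale0r add0r linearZ /= /B TE.
rewrite linearZ /= -scalerN; congr (_ *: _).
(* The derivative of the [m]-th fibre coordinate along [S] is the [m]-th component of [s]. *)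
have := congr1 (fun u : 'rV_(n + k) => u 0 (rshift n m)) (tcoord_vert_lift bc s Cp).
rewrite row_mxEr bproj_fibpt => <-; rewrite [RHS]mxE; congr (S p _).
by apply/funext => q; rewrite mxE.
Qed.

(** From the torsion equation for [app Jh X] and [S], subtract [Jh] of the one for [X] and [S]. The
    derivatives of [X] along [S] cancel because [nabla] commutes with [Jh], and the two quarters of
    the Nijenhuis tensor add up to the half by which [J0] differs from [Jh]. *)
Lemma torsion_identity (nabla : forall a, tangent E a -> vfield E -> tangent E a)
    (v : 'rV[R]_(n + k)) (X := dcoord C v) :
    (forall eta, T p eta = Jh p eta) -> minimal_connection Jh nabla ->
  nabla p (Jh p (X p)) S - Jh p (nabla p (X p) S) =
    lie (app J0 X) S p - Jh p (lie X S p).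
Proof.
move=> TE [_ nJ tor]; have [sW lieW] := lie_nijenhuis_radial v TE.
have sS := vert_lift_smooth.
have sX : vf_smooth_at p X by exact: dcoord_smooth.
have sJX := smooth_app acJh sX.
have nE : \forall q \near p, app Jh X q + - 2^-1 *: T q (nijenhuis Jh (radial (E := E)) X q)
    = app J0 X q.
  apply: filterS (near_dom Cp) => q Cq.
  by rewrite /app (J0E (dcoord_smooth v aC Cq)) scaleNr.
rewrite -(lie_local _ nE) lieD//; last exact: vf_smoothZ.
rewrite lieZ// lieW (nijenhuis_anti acJh sS sX).
have := tor p (app Jh X) S sJX sS; have := tor p X S sX sS.
rewrite (nijenhuis_app acJh sX sS) nJ// => /eqP; rewrite subr_eq => /eqP E1 /eqP.
rewrite subr_eq => /eqP E2.
have -> : nabla p (X p) S = nabla p (S p) X + (4^-1 *: nijenhuis Jh X S p + lie X S p).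
  by rewrite -E1 addrC subrK.
have -> : nabla p (Jh p (X p)) S = Jh p (nabla p (S p) X) +
    (4^-1 *: (- Jh p (nijenhuis Jh X S p)) + lie (app Jh X) S p).
  by rewrite -E2 addrC subrK.
clear E1 E2; move: (nijenhuis Jh X S p) => N.
rewrite !linearD linearZ !linearN /= opprK; apply: tangent_ext => g _.
by rewrite !(tangent_addE, tangent_oppE, tangent_scaleE); field.
Qed.

(** * The bracket with [J0 X] and the dbar operator of [J0] *)

Section Dbar.
Variable D : forall x, tangent L x -> @bsection _ _ _ _ E -> fib E x.
Hypothesis cD : linear_connection D.
Hypothesis hD : forall t (xi : tangent L x), sec_smooth_at x t ->
  hlift D t (J x xi) = J0 (fibpt (t x)) (hlift D t xi).

(** Complex linearity of the lifts, solved for the differential of the section: the dbar operator of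
    [D] measures how far that differential is from being complex linear. *)
Lemma J0_push_sec t (xi : tangent L x) : sec_smooth_at x t ->
  J0 (fibpt (t x)) (push (fun y => fibpt (t y)) xi) =
  push (fun y => fibpt (t y)) (J x xi) - vert (t x) (D (J x xi) t - j (D xi t)).
Proof.
move=> st; have := hD xi st; rewrite /hlift linearB /= jE => /eqP.
rewrite -subr_eq0 => /eqP H; rewrite -[LHS]addr0 -H.
rewrite -(addrC (- j _)) -scaleN1r (vert_lin bc)// scaleN1r.
apply: tangent_ext => g _.
by rewrite !(tangent_addE, tangent_oppE); ring.
Qed.

Variable xi : tangent L x.
Local Notation X := (dcoord C (row_mx (tcoord c xi) 0)).
Local Notation sigma := (fun y => fpoint C y (fcoord C (s x))).
Local Notation dbar t := (D (J x xi) t - j (D xi t)).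

Let ssigma : sec_smooth_at x sigma. Proof. exact: (sec_smooth_const bc). Qed.

(** The section [b *: sigma] is constant in the chart, so its differential maps [xi] to [X] at
    [b *: s x]. [J0_push_sec] then gives the fibre component, and the dbar operator is linear in
    [b]. *)
Lemma J0X_fibre (b : R) m :
  (J0 (fibpt (b *: s x)) (X (fibpt (b *: s x))) : tangent E _)
    (fun q => chart_coord C q 0 (rshift n m)) = - (b * fcoord C (dbar sigma) 0 m).
Proof.
pose t y := b *: sigma y.
have st : sec_smooth_at x t.
  exact: (sec_smoothZ bc cx (smooth_at_cst x b) ssigma).
have tx : t x = b *: s x by rewrite /t (fcoordK bc).
have t0 (zeta : tangent L x) i : zeta (fun y => fcoord C (t y) 0 i) = 0.
  rewrite -(tangent_cst zeta (b * fcoord C (s x) 0 i)); apply: tangent_local.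
  by apply: filterS (near_dom cx) => y cy; rewrite (fcoordZ bc)// (fpointK bc)// [LHS]mxE.
rewrite -tx; have Ct : chart_dom C (fibpt (t x)) by exact: (dom_fibpt bc).
have -> : X (fibpt (t x)) = push (fun y => fibpt (t y)) xi.
  apply: (tcoord_inj aC Ct); rewrite (tcoord_push_sec bc)// tcoord_dcoord//.
  by congr row_mx; apply/rowP => i; rewrite [RHS]mxE t0 mxE.
rewrite J0_push_sec//.
set w := dbar t; have -> : w = b *: dbar sigma.
  by rewrite /w /t !(connectionZ cD)// linearZ /= scalerBr.
rewrite -[LHS]/(((_ : tangent E _) : (E -> R) -> R) _).
set eta := push _ _ - _.
have -> : eta (fun q => chart_coord C q 0 (rshift n m)) = tcoord C eta 0 (rshift n m).
  by rewrite mxE.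
rewrite /eta linearB /= (tcoord_push_sec bc)// (tcoord_vert bc)//.
rewrite opp_row_mx add_row_mx row_mxEr (fcoordZ bc)// [LHS]mxE [X in X + _]mxE t0 add0r.
by rewrite [LHS]mxE [X in - X]mxE.
Qed.

(** The fibre part of the bracket of [J0 X] with [S] is the derivative of [s] along [J x xi] minus
    the derivative along [S] of the fibre part of [J0 X], which [J0X_fibre] provides; together they
    rebuild the operator on [s]. *)
Lemma lie_dbar :
  rsubmx (tcoord C (lie (app J0 X) S p - Jh p (lie X S p))) = fcoord C (dbar s).
Proof.
have sS := vert_lift_smooth.
have sX : vf_smooth_at p X by exact: dcoord_smooth.
have sJX := smooth_app acJ0 sX.
have Xp : X p = push (zsec (E := E)) xi.
  by apply: (tcoord_inj aC Cp); rewrite (tcoord_push_zsec bc)// tcoord_dcoord.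
have JXp : app J0 X p = push (zsec (E := E)) (J x xi).
  by rewrite /app J0_zsec Xp Jh_zsec.
have zsm : map_smooth_at x (zsec (E := E)) by exact: (sec_smooth0 bc cx).
(* Along the zero section the fibre components of [S] are those of [s]. *)
have pushs (zeta : tangent L x) m :
    (push (zsec (E := E)) zeta : tangent E p) (fun q : E => S q (fun a => chart_coord C a 0 (rshift n m)))
    = zeta (fun y => fcoord C (s y) 0 m).
  rewrite pushE//; last by apply: sS; exact: smooth_at_coord.
  apply: tangent_local; apply: filterS (near_dom cx) => y cy /=.
  have Cy : chart_dom C (zsec (E := E) y) by exact: (dom_fibpt bc).
  have := congr1 (fun u : 'rV_(n + k) => u 0 (rshift n m)) (tcoord_vert_lift bc s Cy).
  by rewrite row_mxEr bproj_fibpt => <-; rewrite mxE.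
(* The components of [X] and the base components of [S] are constant, so only derivatives of the
   fibre components of [S] along [X] survive. *)
have lieXS : lie X S p = vert 0 (fpoint C x (\row_m xi (fun y => fcoord C (s y) 0 m))).
  apply: (tcoord_inj aC Cp); rewrite (tcoord_vert bc)// (fpointK bc)//.
  apply/rowP => i; rewrite [LHS]mxE lieE//; last exact: smooth_at_coord.
  rewrite (_ : S p _ = 0) ?subr0; last first.
    rewrite -(tangent_cst (S p) (row_mx (tcoord c xi) 0 0 i)); apply: tangent_local.
    apply: filterS (near_dom Cp) => q Cq.
    by have /rowP/(_ i) := tcoord_dcoord (row_mx (tcoord c xi) 0) aC Cq; rewrite mxE.
  rewrite Xp; case: (split_ordP i) => l ->; last by rewrite pushs row_mxEr mxE.
  rewrite row_mxEl mxE -(tangent_cst (push (zsec (E := E)) xi : tangent E p) 0).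
  apply: tangent_local; apply: filterS (near_dom Cp) => q Cq.
  have /rowP/(_ (lshift k l)) := tcoord_vert_lift bc s Cq.
  by rewrite row_mxEl !mxE.
have -> : Jh p (lie X S p) = vert 0 (j (fpoint C x (\row_m xi (fun y => fcoord C (s y) 0 m)))).
  by rewrite -J0_zsec lieXS; exact: jE.
rewrite linearB /= (tcoord_vert bc)// linearB /= row_mxKr.
(* [connection_const] separates the derivatives of the components of [s] from the operator on
   [sigma], which has the same value at [x]. *)
have -> : fcoord C (dbar s) = (\row_m J x xi (fun y => fcoord C (s y) 0 m)) + fcoord C (dbar sigma)
    - fcoord C (j (fpoint C x (\row_m xi (fun y => fcoord C (s y) 0 m)))).
  rewrite (connection_const cD bc (J x xi) cx ss) (connection_const cD bc xi cx ss).
  rewrite linearD /= !(fcoordB bc)// !(fcoordD bc)// (fpointK bc)//.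
  by rewrite opprD !addrA; congr (_ - _ - _); rewrite addrC.
congr (_ - _); apply/rowP => m; rewrite [LHS]mxE [LHS]mxE [RHS]mxE [in RHS]mxE.
rewrite lieE//; last exact: smooth_at_coord.
rewrite JXp pushs; congr (_ + _).
have Sp : S p = vert (0 : fib E x) (s x).
  by apply: (tcoord_inj aC Cp); rewrite (tcoord_vert_lift bc)// (tcoord_vert bc)// bproj_fibpt.
rewrite Sp (vertE bc)//; last by apply: sJX; exact: smooth_at_coord.
rewrite /app.
(* Along the fibre line through [s x] the component is linear in [t], so its derivative is the
   slope. *)
rewrite (_ : (fun t : R => _) = (fun t : R => t * - fcoord C (dbar sigma) 0 m)); last first.
  by apply/funext => t; rewrite add0r J0X_fibre mulrN.
by rewrite derive1E derive_val scaler0 add0r [_%:A]mulr1 opprK.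
Qed.

End Dbar.

End Along.

End InChart.

Lemma normal_form_is_NBI (nabla : forall a, tangent E a -> vfield E -> tangent E a) :
  (forall x (eta : tangent E (zsec x)), T (zsec x) eta = Jh (zsec x) eta) ->
  minimal_connection Jh nabla -> is_NBI Jh nabla J0.
Proof.
move=> TE mn; case: PH0 => _ _ _ fibreJ0 [D [cD hD]].
split=> [x s xi xi' ss|x v w]; have [j jE] := fibreJ0 x;
    have [c [C [bc cx]]] := @bundle_chart_exists _ _ _ _ E x;
    have [ac aC _ _] := bc; have Cx : chart_dom C (zsec x) by exact: (dom_fibpt bc).
  rewrite (Jh_zsec bc cx) => xiE.
  (* [push zsec] is injective, so [xi'] can only be [J x xi]. *)
  have <- : J x xi = xi'.
    apply: (tcoord_inj ac cx); have := congr1 (fun eta : tangent E (zsec x) => tcoord C eta) xiE.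
    by rewrite !(tcoord_push_zsec bc)// => /eq_row_mx[].
  have Xx : dcoord C (row_mx (tcoord c xi) 0) (zsec x) = push (zsec (E := E)) xi.
    by apply: (tcoord_inj aC Cx); rewrite (tcoord_push_zsec bc)// tcoord_dcoord.
  (* Fibre components of the torsion identity: its left side is the dbar operator of the normal
     connection, its right side that of [D]. *)
  have := torsion_identity bc cx ss (row_mx (tcoord c xi) 0) (TE x) mn.
  rewrite Xx (Jh_zsec bc cx) => /(congr1 (fun eta => rsubmx (tcoord C eta))).
  rewrite (lie_dbar bc cx jE ss cD (hD x)) !linearB /= -!(fcoord_normal_class bc)//.
  rewrite (normal_class_Jh bc cx jE) -/(normal_connection nabla _ s) -/(normal_connection nabla xi s).
  rewrite -!(fcoordB bc)// => /(fcoord_inj bc cx) dbarE.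
  (* Equality of the two operators transfers complex linearity from the lifts of [D] to those of the
     normal connection. *)
  rewrite /hlift ?linearB /= (J0_push_sec bc cx jE (hD x) _ ss) -dbarE jE.
  set u := normal_connection _ _ _; set u' := normal_connection _ _ _.
  rewrite -(addrC (- j u')) -scaleN1r (vert_lin bc)// scaleN1r.
  apply: tangent_ext => g _.
  by rewrite !(tangent_addE, tangent_oppE); ring.
have ncE : normal_class (vert 0 w : tangent E (zsec x)) = w.
  by apply: (fcoord_inj bc cx); rewrite (fcoord_normal_class bc)// (tcoord_vert bc)// row_mxKr.
by rewrite (normal_class_Jh bc cx jE) ncE jE.
Qed.

End ZeroSection.

(** * Uniqueness of the NB-I structure *)

Section Uniqueness.
Context {R : realType} {n k : nat} {L : manifold R n} {E : vbundle k L}.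

(** Subtracting from [eta] the horizontal lift of its projection leaves zero base components, hence
    a vertical vector. *)
Lemma tangent_split (D : forall x, tangent L x -> @bsection _ _ _ _ E -> fib E x)
    x s (eta : tangent E (fibpt (s x))) : sec_smooth_at x s ->
  exists (xi : tangent L x) (w : fib E x), eta = hlift D s xi + vert (s x) w.
Proof.
move=> ss; have [c [C [bc cx]]] := @bundle_chart_exists _ _ _ _ E x; have [ac aC _ _] := bc.
have Cs : chart_dom C (fibpt (s x)) by exact: (dom_fibpt bc).
exists (push (@bproj _ _ _ _ E) eta).
pose zeta := eta - hlift D s (push (@bproj _ _ _ _ E) eta).
exists (fpoint C x (rsubmx (tcoord C zeta))).
suff <- : zeta = vert (s x) (fpoint C x (rsubmx (tcoord C zeta))).
  by rewrite /zeta addrC subrK.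
apply: (tcoord_inj aC Cs); rewrite (tcoord_vert bc)// (fpointK bc)//.
rewrite -[LHS]hsubmxK; congr row_mx.
rewrite /zeta /hlift !linearB /= (tcoord_push_sec bc)// (tcoord_vert bc)//.
rewrite !row_mxKl !oppr0 addr0 (tcoord_push_bproj bc) ?subrr//.
exact: bproj_fibpt.
Qed.

Lemma is_NBI_unique (J : endo L) (Jh : endo E) nabla (J1 J2 : endo E) : PH_bundle J Jh ->
  is_NBI Jh nabla J1 -> is_NBI Jh nabla J2 -> forall a (xi : tangent E a), J1 a xi = J2 a xi.
Proof.
move=> PHh [H1 V1] [H2 V2] a; rewrite -(fibpt_fibvec a).
move: (bproj a) (fibvec a) => x v eta.
have [c [C [bc cx]]] := @bundle_chart_exists _ _ _ _ E x.
(* Horizontal lifts are indexed by sections, so the point [v] needs a smooth section through it. *)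
pose s y := fpoint C y (fcoord C v).
have ss : sec_smooth_at x s by exact: (sec_smooth_const bc).
move: eta; have <- : s x = v by exact: (fcoordK bc).
move=> eta; have [xi [w ->]] := tangent_split (normal_connection nabla) eta ss.
have JE := Jh_zsec PHh bc cx xi.
by rewrite (linearD (J1 _)) (linearD (J2 _)) /= V1 V2 (H1 _ _ _ _ ss JE) (H2 _ _ _ _ ss JE).
Qed.

End Uniqueness.

Theorem theorem17 (R : realType) (n k : nat) (L : manifold R n)
    (E : vbundle k L) (J : endo L) (Jh J0 : endo E) :
  PH_bundle J Jh ->
  normally_integrable_form J Jh J0 ->
  forall nabla : (forall a, tangent E a -> vfield E -> tangent E a),
    minimal_connection Jh nabla ->
    transport_preserves_zsec nabla ->
    forall JN : endo E,
      is_NBI Jh nabla JN <-> (forall a (xi : tangent E a), JN a xi = J0 a xi).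
Proof.
move=> PHh [PH0 _ rel] nabla mn _ JN.
have NBI0 : is_NBI Jh nabla J0.
  have acJh : almost_complex Jh by case: PHh.
  have acJ0 : almost_complex J0 by case: PH0.
  (* The second form of the relation is [J0E] with [T] equal to [Jh]; the first, solved for [J0], is
     [J0E] with [T] equal to [J0]. *)
  case: rel => rel; last exact: (normal_form_is_NBI PHh PH0 acJh rel _ mn).
  have rel' a X : vf_smooth_at a X ->
      J0 a (X a) = Jh a (X a) - 2^-1 *: J0 a (nijenhuis Jh (radial (E := E)) X a).
    by move=> /rel ->; rewrite addrK.
  (* It remains to see that [T] agrees with [Jh] on the zero section, which for [J0] is
     [J0_zsec]. *)
  apply: (normal_form_is_NBI PHh PH0 acJ0 rel' _ mn) => x eta.
  have [c [C [bc cx]]] := @bundle_chart_exists _ _ _ _ E x.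
  exact: (J0_zsec PHh rel' bc cx eta).
split=> [NBI|JNE]; first exact: is_NBI_unique PHh NBI NBI0.
case: NBI0 => H V; split=> [x s xi xi' ss JE|x v w]; rewrite JNE; last exact: V.
exact: H ss JE.
Qed.
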